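(* Let $B$ be a finite dimensional algebra over a field with a subalgebra $\mathfrak a$ satisfying the conditions: (1) $\mathfrak a$ is positively graded and Koszul; (2) $(\operatorname{rad}\mathfrak a)B=\operatorname{rad}B$; (3) every projective $B$-module is projective as an $\mathfrak a$-module (equivalently, $B$ is projective as a left $\mathfrak a$-module). Then $\operatorname{gr}B$ is Koszul.
   Context: Modules are finite dimensional left modules, $\operatorname{rad}$ denotes the Jacobson radical, and $\operatorname{gr}B=\bigoplus_{n\ge0}\operatorname{rad}^nB/\operatorname{rad}^{n+1}B$ with $\operatorname{rad}^nB=(\operatorname{rad}B)^n$. A positively graded finite dimensional algebra $C=\bigoplus_{n\ge0}C_n$ is Koszul if, for all irreducible modules $L,L'$ regarded as graded modules concentrated in grade $0$, $\mathrm{ext}^n_C(L,L'(r))\neq0$ implies $n=r$; here $\mathrm{ext}^n_C$ denotes Ext in the category of finite dimensional $\mathbb Z$-graded $C$-modules with degree-preserving maps, and $M(r)_n=M_{n-r}$. (In particular then $C_0$ is semisimple and $C_n=(C_1)^n$ for $n\ge1$.) *)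

(* Defs.v *)
From HB Require Import structures.
From mathcomp Require Import all_boot all_order all_algebra all_field.
From mathcomp Require Import boolp.

Set Implicit Arguments.
Unset Strict Implicit.
Unset Printing Implicit Defensive.

Import GRing.Theory.
Local Open Scope ring_scope.

(* The subspace cut out by a predicate; meaningful when P is closed under
   linear combinations (mem_vspaceof), and 0 by convention otherwise. *)
Section VspaceOf.
Variables (F : fieldType) (V : vectType F).

Definition vspaceof (P : V -> Prop) : {vspace V} :=
  if pselect (exists U : {vspace V}, forall x, x \in U <-> P x) is left h
  then projT1 (cid h) else 0%VS.

Lemma mem_vspaceof (P : V -> Prop) (x : V) :
    P 0 -> (forall c u v, P u -> P v -> P (c *: u + v)) ->
  x \in vspaceof P <-> P x.
Proof.
move=> P0 Plin; rewrite /vspaceof; case: pselect => [h | []].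
  by case: cid => U /= ->.
pose good k := `[< exists U : {vspace V}, (forall y, y \in U -> P y) /\ \dim U = k >].
have g0 : exists k, good k.
  exists 0; apply/asboolP; exists 0%VS; split; last exact: dimv0.
  by move=> y; rewrite memv0 => /eqP ->.
have gb k : good k -> (k <= \dim {:V})%N.
  by move/asboolP => [U [_ <-]]; rewrite dimvS ?subvf.
case: (ex_maxnP g0 gb) => k /asboolP[U [UP dU]] maxk.
exists U => y; split; first exact: UP.
move=> Py; apply/negPn/negP => yU.
have : good (\dim (<[y]> + U)).
  apply/asboolP; exists (<[y]> + U)%VS; split => // z.
  by case/memv_addP => _ /vlineP[c ->] [u Uu ->]; apply: Plin => //; apply: UP.
move/maxk; rewrite -dU leqNgt => /negP[].
rewrite ltn_neqAle dimvS ?addvSr // andbT; apply/negP => /eqP e.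
have : (U == <[y]> + U)%VS by rewrite eqEdim addvSr e leqnn.
move/eqP => e2; move: yU; rewrite e2 => /negP; apply.
by apply: (subvP (addvSl _ _)); exact: memv_line.
Qed.

Definition decomposition (I : eqType) (W : I -> {vspace V}) : Prop :=
  exists s : seq I,
    [/\ uniq s, forall i, i \notin s -> W i = 0%VS,
        (\sum_(i <- s) W i)%VS = fullv & directv (\sum_(i <- s) W i)].

End VspaceOf.

Section Radical.
Variables (F : fieldType) (B : falgType F).
Implicit Types (I J K M N : {vspace B}) (x y : B).

Definition left_ideal I : Prop := ({:B} * I <= I)%VS.

Definition maximal_left_ideal I : Prop :=
  [/\ left_ideal I, I != fullv &
      forall K, left_ideal K -> (I <= K)%VS -> K = I \/ K = fullv].

Definition jacobson : {vspace B} :=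
  vspaceof (fun x => forall I, maximal_left_ideal I -> x \in I).

(* As opposed to expv, the zeroth power is B and not the line spanned by 1. *)
Definition radpow (n : nat) : {vspace B} :=
  if n is 0 then fullv else (jacobson ^+ n)%VS.

Lemma left_idealP I :
  left_ideal I <-> forall b x, x \in I -> b * x \in I.
Proof.
split=> [/prodvP h b x Ix | h]; first exact: h (memvf _) Ix.
by apply/prodvP => b x _; apply: h.
Qed.

Lemma mem_jacobson x :
  x \in jacobson <-> forall I, maximal_left_ideal I -> x \in I.
Proof.
apply: mem_vspaceof => [I _ | c u v hu hv I hI]; first exact: mem0v.
by rewrite memvD ?memvZ ?hu ?hv.
Qed.

Definition maximal_sub N M : Prop :=
  [/\ left_ideal N, (N <= M)%VS, N != M &
      forall K, left_ideal K -> (N <= K)%VS -> (K <= M)%VS -> K = N \/ K = M].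

Lemma ex_maximal_sub M : left_ideal M -> M != 0%VS -> exists N, maximal_sub N M.
Proof.
move=> lM M0.
pose good k := `[< exists N, [/\ left_ideal N, (N <= M)%VS, N != M & \dim N = k] >].
have g0 : exists k, good k.
  exists 0; apply/asboolP; exists 0%VS; split; last exact: dimv0.
  - by apply/left_idealP => b x; rewrite !memv0 => /eqP ->; rewrite mulr0.
  - exact: sub0v.
  - by rewrite eq_sym.
have gb k : good k -> (k <= \dim M)%N.
  by move/asboolP => [N [_ sNM _ <-]]; rewrite dimvS.
case: (ex_maxnP g0 gb) => k /asboolP[N [lN sNM nNM dN]] maxk.
exists N; split=> // K lK sNK sKM.
have [->|nKM] := eqVneq K M; [by right | left].
apply/eqP; rewrite eq_sym eqEdim sNK dN maxk //.
by apply/asboolP; exists K.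
Qed.

Lemma maximal_sub_ann N M w : left_ideal M -> maximal_sub N M ->
  w \in M -> w \notin N -> maximal_left_ideal (amulr w @^-1: N)%VS.
Proof.
move=> /left_idealP lM [/left_idealP lN sNM nNM maxN] wM wN.
have annE b : (b \in (amulr w @^-1: N)%VS) = (b * w \in N).
  by rewrite -memv_preim lfunE.
split.
- by apply/left_idealP => b x; rewrite !annE -mulrA; apply: lN.
- by apply: contraNneq wN => e; rewrite -(mul1r w) -annE e memvf.
move=> K /left_idealP lK sIK.
pose L := (amulr w @: K + N)%VS.
have LE y : y \in L <-> exists2 k, k \in K & y - k * w \in N.
  split=> [/memv_addP[_ /memv_imgP[k kK ->] [n nN ->]] | [k kK yN]].
    by exists k => //; rewrite lfunE /= addrC addKr.
  apply/memv_addP; exists (k * w); last by exists (y - k * w) => //; rewrite addrC subrK.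
  by apply/memv_imgP; exists k; rewrite // lfunE.
have lL : left_ideal L.
  apply/left_idealP => b y /LE[k kK h]; apply/LE; exists (b * k); first exact: lK.
  by rewrite -mulrA -mulrBr; apply: lN.
have sLM : (L <= M)%VS.
  apply/subvP => y /LE[k kK /(subvP sNM) h].
  by rewrite -(subrK (k * w) y) memvD // lM.
case: (maxN L lL (addvSr _ _) sLM) => [LN | LM].
  left; apply/eqP; rewrite eqEsubv sIK andbT; apply/subvP => k kK.
  by rewrite annE -LN; apply/LE; exists k => //; rewrite subrr mem0v.
right; apply/eqP; rewrite eqEsubv subvf /=; apply/subvP => b _.
move: wM; rewrite -LM => /LE[k kK h].
have k1 : 1 \in K.
  rewrite -(subrK k 1) memvD //; apply: (subvP sIK).
  by rewrite annE mulrBl mul1r.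
by rewrite -(mulr1 b) lK.
Qed.

Lemma rad_maximal_sub N M x w : left_ideal M -> maximal_sub N M ->
  x \in jacobson -> w \in M -> x * w \in N.
Proof.
move=> lM mN /mem_jacobson xJ wM.
have [wN|wN] := boolP (w \in N).
  by case: mN => /left_idealP lN _ _ _; apply: lN.
by have := xJ _ (maximal_sub_ann lM mN wM wN); rewrite -memv_preim lfunE.
Qed.

Lemma rad_nakayama M : left_ideal M -> (M <= jacobson * M)%VS -> M = 0%VS.
Proof.
move=> lM sM; apply/eqP/negPn/negP => /(ex_maximal_sub lM)[N mN].
have [_ sNM /eqP nNM _] := mN; apply: nNM; apply/eqP.
rewrite eqEsubv sNM (subv_trans sM) //; apply/prodvP => x w.
exact: rad_maximal_sub mN.
Qed.

Lemma left_ideal_fullv : left_ideal fullv.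
Proof. exact: subvf. Qed.

Lemma rad_mull b x : x \in jacobson -> b * x \in jacobson.
Proof.
move/mem_jacobson => xJ; apply/mem_jacobson => I mI.
have [/left_idealP lI _ _] := mI; exact/lI/xJ.
Qed.

Lemma rad_mulr b x : x \in jacobson -> x * b \in jacobson.
Proof.
move=> xJ; apply/mem_jacobson => I [lI nI maxI].
apply: (@rad_maximal_sub I fullv) => //; [| | exact: memvf].
  exact: left_ideal_fullv.
by split=> //; [exact: subvf | move=> K lK sIK _; apply: maxI].
Qed.

Lemma radpowS n : radpow n.+1 = (jacobson * radpow n)%VS.
Proof.
case: n => [|n]; last by rewrite /radpow expvSl.
rewrite /= expv1; apply/eqP; rewrite eqEsubv; apply/andP; split.
  by apply/subvP => x xJ; rewrite -(mulr1 x) memv_mul ?memvf.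
by apply/prodvP => x b xJ _; apply: rad_mulr.
Qed.

Lemma radpow_left n : left_ideal (radpow n).
Proof.
elim: n => [|n IH]; first exact: left_ideal_fullv.
rewrite radpowS /left_ideal prodvA prodvSl //.
by apply/prodvP => b x _; apply: rad_mull.
Qed.

Lemma radpow_decr n : (radpow n.+1 <= radpow n)%VS.
Proof.
by rewrite radpowS (subv_trans _ (@radpow_left n)) // prodvSl ?subvf.
Qed.

Lemma radpow_right n x b : x \in radpow n -> x * b \in radpow n.
Proof.
suff : (radpow n * fullv <= radpow n)%VS by move/prodvP => h xn; rewrite h ?memvf.
elim: n => [|n IH]; first exact: subvf.
by rewrite radpowS -prodvA prodvSr.
Qed.

Lemma radpowM m n x y :
  x \in radpow m -> y \in radpow n -> x * y \in radpow (m + n).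
Proof.
move=> xm yn; case: m xm => [_|m xm].
  by rewrite add0n; have/left_idealP := @radpow_left n; apply.
case: n yn => [_|n yn]; first by rewrite addn0 radpow_right.
have -> : radpow (m.+1 + n.+1) = (jacobson ^+ (m.+1 + n.+1))%VS by [].
by rewrite expvD memv_mul.
Qed.

Lemma dim_radpow n : (\dim (radpow n) + n <= \dim {:B})%N \/ radpow n = 0%VS.
Proof.
elim: n => [|n [IH|IH]]; first by left; rewrite addn0.
- have [r0|r0] := eqVneq (radpow n) 0%VS.
    by right; apply/eqP; rewrite -subv0 -r0 radpow_decr.
  left; rewrite addnS (leq_trans _ IH) // ltn_add2r ltn_neqAle dimvS ?radpow_decr //.
  rewrite andbT; apply: contra_neqN r0 => /eqP e.
  apply: rad_nakayama (@radpow_left n) _; rewrite -radpowS.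
  have : (radpow n.+1 == radpow n) by rewrite eqEdim radpow_decr e leqnn.
  by move/eqP ->.
- by right; apply/eqP; rewrite -subv0 -IH radpow_decr.
Qed.

Lemma radpow_nil n : (\dim {:B} <= n)%N -> radpow n = 0%VS.
Proof.
move=> le; case: (dim_radpow n) => // h; apply/eqP; rewrite -dimv_eq0.
by move: (leq_trans h le); rewrite -{3}[n]add0n leq_add2r leqn0.
Qed.

End Radical.

(* gr B is realised inside the functions n |-> x_n with values in B, where
   rad^n B / rad^(n+1) B is represented by the complement
   radpow n :\: radpow n.+1 of rad^(n+1) B in rad^n B.  Only the degrees
   n < dim B occur since rad^n B = 0 for n >= dim B (radpow_nil).  That this is
   the usual algebra is gr_symbol1, gr_symbolM, gr_symbol_eq0, gr_graded. *)
Section AssociatedGraded.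
Variables (F : fieldType) (B : falgType F).
Let N := \dim {:B}.
Let R (n : nat) : {vspace B} := radpow B n.

Definition gr_sigma (n : nat) : 'End(B) := addv_pi1 (R n) (R n.+1).

Lemma gr_sigmaR n x : gr_sigma n x \in R n.
Proof. exact: memv_pi1. Qed.

Lemma gr_sigmaW n x : gr_sigma n x \in (R n :\: R n.+1)%VS.
Proof. by rewrite /gr_sigma /addv_pi1 memv_pi. Qed.

Lemma gr_sigmaB n x : x \in R n -> x - gr_sigma n x \in R n.+1.
Proof.
move=> xn; have : x \in (R n + R n.+1)%VS by apply: (subvP (addvSl _ _)).
by move/addv_pi1_pi2 => {1}<-; rewrite addrAC subrr add0r; apply: memv_pi2.
Qed.

Lemma gr_sigma0 n x : x \in R n.+1 -> gr_sigma n x = 0.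
Proof.
move=> xS; have xn := subvP (radpow_decr B n) _ xS.
have h1 := gr_sigmaW n x.
have h2 : gr_sigma n x \in R n.+1.
  by rewrite -(subKr x (gr_sigma n x)) memvB // gr_sigmaB.
apply/eqP; rewrite -memv0 -(capv_diff (R n) (R n.+1)).
by rewrite memv_cap; apply/andP.
Qed.

Lemma gr_sigma_eq0 n x : x \in R n -> (gr_sigma n x == 0) = (x \in R n.+1).
Proof.
move=> xn; apply/eqP/idP => [e | /gr_sigma0 //].
by rewrite -(subr0 x) -e gr_sigmaB.
Qed.

Lemma gr_sigma_id n x : x \in (R n :\: R n.+1)%VS -> gr_sigma n x = x.
Proof.
move=> xW; rewrite /gr_sigma /addv_pi1 daddv_pi_id //.
by rewrite capv_diff.
Qed.

Lemma gr_sigma_congr n x y : x - y \in R n.+1 -> gr_sigma n x = gr_sigma n y.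
Proof. by move/gr_sigma0/eqP; rewrite linearB subr_eq0 => /eqP. Qed.

Lemma gr_sigmaMl m n p x y z : x * y \in R (m + n) -> z \in R p ->
  gr_sigma (m + n + p) (gr_sigma (m + n) (x * y) * z) =
  gr_sigma (m + n + p) (x * y * z).
Proof.
move=> xy zp; apply/esym/gr_sigma_congr; rewrite -mulrBl -addSn.
by apply: radpowM => //; apply: gr_sigmaB.
Qed.

Lemma gr_sigmaMr m n p x y z : y * z \in R (n + p) -> x \in R m ->
  gr_sigma (m + (n + p)) (x * gr_sigma (n + p) (y * z)) =
  gr_sigma (m + (n + p)) (x * (y * z)).
Proof.
move=> yz xm; apply/esym/gr_sigma_congr; rewrite -mulrBr -addnS.
by apply: radpowM => //; apply: gr_sigmaB.
Qed.

Definition gr_space : {vspace {ffun 'I_N -> B}} :=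
  vspaceof (fun f : {ffun 'I_N -> B} =>
              forall n : 'I_N, f n \in (R n :\: R n.+1)%VS).

Lemma mem_gr_space f :
  f \in gr_space <-> forall n : 'I_N, f n \in (R n :\: R n.+1)%VS.
Proof.
apply: mem_vspaceof => [n | c u v hu hv n]; rewrite !ffunE ?mem0v //.
by rewrite memvD ?memvZ.
Qed.

Definition gr : Type := subvs_of gr_space.
HB.instance Definition _ := Vector.copy gr (subvs_of gr_space).

Definition gr_fun (u : gr) : {ffun 'I_N -> B} := vsval u.

Lemma gr_funW u n : gr_fun u n \in (R n :\: R n.+1)%VS.
Proof. by have /mem_gr_space := subvsP u; apply. Qed.

Lemma gr_funR u n : gr_fun u n \in R n.
Proof. exact: (subvP (diffvSl _ _)) (gr_funW u n). Qed.

Lemma gr_eq (u v : gr) : (forall n, gr_fun u n = gr_fun v n) -> u = v.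
Proof. by move=> h; apply: val_inj; apply/ffunP. Qed.

Lemma gr_funD u v n : gr_fun (u + v) n = gr_fun u n + gr_fun v n.
Proof. by rewrite /gr_fun linearD ffunE. Qed.

Lemma gr_funZ c u n : gr_fun (c *: u) n = c *: gr_fun u n.
Proof. by rewrite /gr_fun linearZ ffunE. Qed.

Lemma gr_fun0 n : gr_fun 0 n = 0.
Proof. by rewrite /gr_fun linear0 ffunE. Qed.

Definition gr_mk (f : 'I_N -> B) : gr :=
  vsproj gr_space [ffun n : 'I_N => gr_sigma n (f n)].

Lemma gr_mkE f n : gr_fun (gr_mk f) n = gr_sigma n (f n).
Proof.
rewrite /gr_fun vsprojK ?ffunE //.
by apply/mem_gr_space => k; rewrite ffunE gr_sigmaW.
Qed.

(* The map x |-> x + rad^(n+1) B, to be used for x in rad^n B. *)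
Definition gr_symbol_fun (n : nat) (x : B) : gr :=
  gr_mk (fun i => if i == n :> nat then x else 0).

Lemma gr_symbol_funE n x i :
  gr_fun (gr_symbol_fun n x) i = if i == n :> nat then gr_sigma n x else 0.
Proof. by rewrite gr_mkE; case: eqP => [->|_] //; rewrite linear0. Qed.

Lemma gr_symbol_linear n : linear (gr_symbol_fun n).
Proof.
move=> c x y; apply: gr_eq => i.
rewrite gr_funD gr_funZ !gr_symbol_funE linearP.
by case: eqP => _ //; rewrite scaler0 addr0.
Qed.

HB.instance Definition _ n :=
  GRing.isLinear.Build F B gr _ (gr_symbol_fun n) (@gr_symbol_linear n).

Definition gr_symbol (n : nat) : 'Hom(B, gr) := linfun (gr_symbol_fun n).

Definition gr_one : gr := gr_symbol 0 1.

Definition gr_mul (u v : gr) : gr :=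
  gr_mk (fun k : 'I_N => \sum_(i < N) \sum_(j < N | (i + j)%N == k)
                           gr_fun u i * gr_fun v j).

Lemma gr_mulE u v k : gr_fun (gr_mul u v) k =
  \sum_(i < N) \sum_(j < N | (i + j)%N == k)
     gr_sigma k (gr_fun u i * gr_fun v j).
Proof.
rewrite gr_mkE linear_sum /=; apply: eq_bigr => i _.
by rewrite linear_sum.
Qed.

Lemma gr_mulA : associative gr_mul.
Proof.
move=> u v w; apply: gr_eq => k; rewrite !gr_mulE.
pose T (a b c : 'I_N) := gr_sigma k (gr_fun u a * gr_fun v b * gr_fun w c).
transitivity (\sum_(a < N) \sum_(b < N) \sum_(c < N | (a + b + c)%N == k) T a b c).
  apply: eq_bigr => a _.
  transitivity (\sum_(l < N | (a + l)%N == k) \sum_(b < N)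
      \sum_(c < N | (b + c)%N == l) T a b c).
    apply: eq_bigr => l /eqP e.
    rewrite gr_mulE mulr_sumr linear_sum /=; apply: eq_bigr => b _.
    rewrite mulr_sumr linear_sum /=; apply: eq_bigr => c /eqP e2.
    rewrite /T -e -e2 gr_sigmaMr ?mulrA ?gr_funR //.
    by apply: radpowM; apply: gr_funR.
  rewrite exchange_big /=; apply: eq_bigr => b _.
  rewrite (exchange_big_dep xpredT) //= [RHS]big_mkcond /=; apply: eq_bigr => c _.
  case: eqP => e.
    have lt : (b + c < N)%N.
      by apply: leq_ltn_trans (ltn_ord k); rewrite -e -addnA leq_addl.
    rewrite (big_pred1 (Ordinal lt)) // => l /=.
    rewrite -val_eqE /= eq_sym [LHS]andbC eq_sym.
    case: eqP => //= el; apply/eqP; rewrite el addnA e //.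
  apply: big_pred0 => l; apply/negP => /andP[/eqP e1 /eqP e2].
  by apply: e; rewrite -e1 -e2 addnA.
transitivity (\sum_(l < N) \sum_(c < N | (l + c)%N == k) \sum_(a < N)
      \sum_(b < N | (a + b)%N == l) T a b c); last first.
  apply: eq_bigr => l _; apply: eq_bigr => c /eqP e.
  rewrite gr_mulE mulr_suml linear_sum /=; apply: eq_bigr => a _.
  rewrite mulr_suml linear_sum /=; apply: eq_bigr => b /eqP e2.
  rewrite /T -e -e2 gr_sigmaMl ?gr_funR //.
  by apply: radpowM; apply: gr_funR.
transitivity (\sum_(a < N) \sum_(l < N) \sum_(c < N | (l + c)%N == k)
      \sum_(b < N | (a + b)%N == l) T a b c); last first.
  rewrite exchange_big; apply: eq_bigr => l _; exact: exchange_big.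
apply: eq_bigr => a _.
transitivity (\sum_(l < N) \sum_(b < N | (a + b)%N == l) \sum_(c < N | (l + c)%N == k)
       T a b c); last first.
  by apply: eq_bigr => l _; rewrite exchange_big.
rewrite [RHS](exchange_big_dep xpredT) //=; apply: eq_bigr => b _.
have [lt|ge] := ltnP (a + b) N.
  rewrite [RHS](big_pred1 (Ordinal lt)) => [//|l /=].
  by rewrite -val_eqE /= eq_sym.
rewrite [RHS]big_pred0; last first.
  move=> l; apply/negP => /eqP e.
  by move: ge; rewrite e leqNgt ltn_ord.
apply: big_pred0 => c; apply/negP => /eqP e.
move: ge; rewrite leqNgt => /negP[]; apply: leq_ltn_trans (ltn_ord k).
by rewrite -e leq_addr.
Qed.

Lemma gr_symbolE n x i :
  gr_fun (gr_symbol n x) i = if i == n :> nat then gr_sigma n x else 0.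
Proof. by rewrite lfunE gr_symbol_funE. Qed.

Lemma gr_dim_gt0 : (0 < N)%N.
Proof. by rewrite /N dimvf FalgType_proper. Qed.

Lemma gr_mul1 : left_id gr_one gr_mul.
Proof.
move=> u; apply: gr_eq => k; rewrite gr_mulE.
rewrite (bigD1 (Ordinal gr_dim_gt0)) //= [X in _ + X]big1 ?addr0; last first.
  move=> i ni; apply: big1 => j _; rewrite gr_symbolE.
  by move: ni; rewrite -val_eqE /= => /negbTE ->; rewrite mul0r linear0.
rewrite (big_pred1 k) => [|j /=]; last by rewrite -val_eqE /= add0n.
rewrite gr_symbolE /= -[RHS](gr_sigma_id (gr_funW u k)).
have := @gr_sigmaMl 0 0 k 1 1 (gr_fun u k).
by rewrite !mul1r; apply; rewrite ?memvf ?gr_funR.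
Qed.

Lemma gr_mulr1 : right_id gr_one gr_mul.
Proof.
move=> u; apply: gr_eq => k; rewrite gr_mulE (bigD1 k) //=.
rewrite [X in _ + X]big1 ?addr0; last first.
  move=> i ni; apply: big1 => j /eqP e; rewrite gr_symbolE.
  case: eqP => [j0|_]; last by rewrite mulr0 linear0.
  by move: ni; rewrite -val_eqE /= -e j0 addn0 eqxx.
rewrite (big_pred1 (Ordinal gr_dim_gt0)) => [|j /=]; last first.
  by rewrite -val_eqE /= -{2}(addn0 k) eqn_add2l.
rewrite gr_symbolE /= -[RHS](gr_sigma_id (gr_funW u k)).
have := @gr_sigmaMr k 0 0 (gr_fun u k) 1 1.
by rewrite !mulr1 !addn0; apply; rewrite ?memvf ?gr_funR.
Qed.

Lemma gr_mulDl : left_distributive gr_mul +%R.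
Proof.
move=> u v w; apply: gr_eq => k; rewrite gr_funD !gr_mulE -big_split /=.
apply: eq_bigr => i _; rewrite -big_split; apply: eq_bigr => j _.
by rewrite gr_funD mulrDl linearD.
Qed.

Lemma gr_mulDr : right_distributive gr_mul +%R.
Proof.
move=> u v w; apply: gr_eq => k; rewrite gr_funD !gr_mulE -big_split /=.
apply: eq_bigr => i _; rewrite -big_split; apply: eq_bigr => j _.
by rewrite gr_funD mulrDr linearD.
Qed.

Lemma gr_symbol_eq0 n x : x \in R n -> (gr_symbol n x == 0) = (x \in R n.+1).
Proof.
move=> xn; apply/eqP/idP => [e | xS]; last first.
  by apply: gr_eq => i; rewrite gr_symbolE gr_sigma0 // gr_fun0 if_same.
have [lt|ge] := ltnP n N.
  rewrite -gr_sigma_eq0 //.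
  have := gr_symbolE n x (Ordinal lt); rewrite e gr_fun0 /= eqxx => <-.
  exact: eqxx.
by move: xn; rewrite /R (radpow_nil ge) memv0 => /eqP ->; rewrite mem0v.
Qed.

Lemma gr_one_neq0 : gr_one != 0.
Proof.
rewrite gr_symbol_eq0 ?memvf //; apply/negP => h1.
have e : R 1 = fullv.
  apply/eqP; rewrite eqEsubv subvf; apply/subvP => b _.
  by rewrite -(mul1r b) radpow_right.
have f0 : ({:B} = 0)%VS.
  apply: rad_nakayama (@left_ideal_fullv _ B) _.
  by rewrite -[X in (_ * X)%VS]/(radpow B 0) -radpowS -/(R 1) e subvv.
by move: gr_dim_gt0; rewrite /N f0 dimv0.
Qed.

HB.instance Definition _ :=
  GRing.Zmodule_isNzRing.Build gr gr_mulA gr_mul1 gr_mulr1 gr_mulDl gr_mulDr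
    gr_one_neq0.

Lemma gr_scaleAl (c : F) (u v : gr) : c *: (u * v) = (c *: u) * v.
Proof.
apply: gr_eq => k; rewrite gr_funZ !gr_mulE scaler_sumr; apply: eq_bigr => i _.
rewrite scaler_sumr; apply: eq_bigr => j _.
by rewrite gr_funZ -scalerAl linearZ.
Qed.

HB.instance Definition _ := GRing.Lmodule_isLalgebra.Build F gr gr_scaleAl.

Lemma gr_scaleAr (c : F) (u v : gr) : c *: (u * v) = u * (c *: v).
Proof.
apply: gr_eq => k; rewrite gr_funZ !gr_mulE scaler_sumr; apply: eq_bigr => i _.
rewrite scaler_sumr; apply: eq_bigr => j _.
by rewrite gr_funZ -scalerAr linearZ.
Qed.

HB.instance Definition _ := GRing.Lalgebra_isAlgebra.Build F gr gr_scaleAr.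
HB.instance Definition _ := Algebra_isFalgebra.Build F gr.

Definition gr_piece (n : nat) : {vspace gr} := (gr_symbol n @: radpow B n)%VS.

Lemma gr_symbol1 : gr_symbol 0 1 = 1.
Proof. by []. Qed.

Lemma gr_symbolM m n x y : x \in radpow B m -> y \in radpow B n ->
  gr_symbol m x * gr_symbol n y = gr_symbol (m + n) (x * y).
Proof.
move=> xm yn; apply: gr_eq => k; rewrite gr_mulE gr_symbolE.
pose t := gr_sigma (m + n) (gr_sigma m x * gr_sigma n y).
have tE : t = gr_sigma (m + n) (x * y).
  apply/esym/gr_sigma_congr.
  rewrite -(subrK (gr_sigma m x * y) (x * y)) -addrA -mulrBl -mulrBr memvD //.
    by rewrite -addSn radpowM ?gr_sigmaB.
  by rewrite -addnS radpowM ?gr_sigmaB ?gr_sigmaR.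
transitivity (\sum_(i < N) \sum_(j < N | (i + j)%N == k)
   if (i == m :> nat) && (j == n :> nat) then t else 0).
  apply: eq_bigr => i _; apply: eq_bigr => j /eqP e; rewrite !gr_symbolE.
  case: eqP => im; last by rewrite mul0r linear0.
  case: eqP => jn; last by rewrite mulr0 linear0.
  by rewrite /t -e im jn.
rewrite -tE; case: eqP => [e|ne]; last first.
  apply: big1 => i _; apply: big1 => j /eqP e; case: andP => // -[/eqP im /eqP jn].
  by case: ne; rewrite -e im jn.
have ltm : (m < N)%N by apply: leq_ltn_trans (ltn_ord k); rewrite e leq_addr.
have ltn' : (n < N)%N by apply: leq_ltn_trans (ltn_ord k); rewrite e leq_addl.
rewrite (bigD1 (Ordinal ltm)) //= [X in _ + X]big1 ?addr0; last first.
  move=> i ni; apply: big1 => j _.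
  by move: ni; rewrite -val_eqE /= => /negbTE ->.
rewrite (big_pred1 (Ordinal ltn')) => [|j /=]; first by rewrite /= !eqxx.
by rewrite -val_eqE /= e eqn_add2l.
Qed.

End AssociatedGraded.

Section Modules.
Variables (F : fieldType) (C : falgType F).

(* Left modules, finite dimensional over F. *)
Record fdmod : Type := FdMod {
  fdmod_sort :> vectType F;
  act : 'Hom(C, 'End(fdmod_sort));
  act1 : act 1 = \1%VF;
  actM : forall a b : C, act (a * b) = (act a \o act b)%VF
}.

Definition module_hom (M N : fdmod) (f : 'Hom(M, N)) : Prop :=
  forall (c : C) (x : M), f (act M c x) = act N c (f x).

Definition submodule (M : fdmod) (U : {vspace M}) : Prop :=
  forall (c : C) (x : M), x \in U -> act M c x \in U.

Definition irreducible (M : fdmod) : Prop :=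
  (fullv : {vspace M}) <> 0%VS /\
  forall U : {vspace M}, submodule U -> U = 0%VS \/ U = fullv.

Definition projective (P : fdmod) : Prop :=
  forall (M N : fdmod) (g : 'Hom(M, N)) (f : 'Hom(P, N)),
    module_hom g -> limg g = fullv -> module_hom f ->
    exists2 h : 'Hom(P, M), module_hom h & (g \o h)%VF = f.

Definition graded_algebra (Cn : nat -> {vspace C}) : Prop :=
  [/\ decomposition Cn, 1 \in Cn 0%N &
      forall m n, (Cn m * Cn n <= Cn (m + n)%N)%VS].

Variable Cn : nat -> {vspace C}.

Record grmod : Type := GrMod {
  grmod_mod :> fdmod;
  piece : int -> {vspace grmod_mod};
  piece_decomposition : decomposition piece;
  piece_act : forall (i : nat) (j : int) (c : C) (x : grmod_mod),
    c \in Cn i -> x \in piece j -> act grmod_mod c x \in piece (i%:Z + j)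
}.

Lemma shift_decomposition (M : grmod) (r : int) :
  decomposition (fun n => piece M (n - r)).
Proof.
have [s [us s0 sf sd]] := piece_decomposition M.
have e : (\sum_(i <- [seq (j + r)%R | j <- s]) piece M (i - r)%R =
          \sum_(i <- s) piece M i)%VS.
  by rewrite big_map; apply: eq_bigr => i _; rewrite addrK.
exists [seq i + r | i <- s]; split.
- by rewrite map_inj_uniq //; apply: addIr.
- move=> i ni; apply: s0; apply: contra ni => h.
  by apply/mapP; exists (i - r); rewrite ?subrK.
- by rewrite e.
move: sd; rewrite !directvE /= e => /eqP ->; rewrite big_map; apply/eqP.
by apply: eq_bigr => i _; rewrite addrK.
Qed.

Lemma shift_act (M : grmod) (r : int) (i : nat) (j : int) (c : C) (x : M) :
  c \in Cn i -> x \in piece M (j - r) -> act M c x \in piece M (i%:Z + j - r).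
Proof. by move=> ci xj; rewrite -addrA piece_act. Qed.

(* M(r), with M(r)_n = M_(n - r). *)
Definition shift (M : grmod) (r : int) : grmod :=
  @GrMod M (fun n => piece M (n - r)) (shift_decomposition M r) (@shift_act M r).

Definition in_grade0 (M : grmod) : Prop :=
  forall i : int, piece M i = if i == 0 then fullv else 0%VS.

Definition graded_hom (M N : grmod) (f : 'Hom(M, N)) : Prop :=
  module_hom f /\ forall i, (f @: piece M i <= piece N i)%VS.

Definition graded_projective (P : grmod) : Prop :=
  forall (M N : grmod) (g : 'Hom(M, N)) (f : 'Hom(P, N)),
    graded_hom g -> limg g = fullv -> graded_hom f ->
    exists2 h : 'Hom(P, M), graded_hom h & (g \o h)%VF = f.

Record resolution (L : grmod) : Type := Resolution {
  res :> nat -> grmod;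
  diff : forall n, 'Hom(res n.+1, res n);
  aug : 'Hom(res 0%N, L);
  res_projective : forall n, graded_projective (res n);
  diff_hom : forall n, graded_hom (diff n);
  aug_hom : graded_hom aug;
  aug_onto : limg aug = fullv;
  aug_exact : lker aug = limg (diff 0);
  diff_exact : forall n, lker (diff n) = limg (diff n.+1)
}.

Definition cocycle (L M : grmod) (P : resolution L) (n : nat)
    (f : 'Hom(P n, M)) : Prop :=
  graded_hom f /\ (f \o diff P n)%VF = 0.

Definition coboundary (L M : grmod) (P : resolution L) (n : nat) :
    'Hom(P n, M) -> Prop :=
  match n return 'Hom(P n, M) -> Prop with
  | 0 => fun f => f = 0
  | m.+1 => fun f => exists2 g : 'Hom(P m, M), graded_hom g & f = (g \o diff P m)%VF
  end.

(* ext^n(L, M) <> 0, where ext^n(L, M) is the n-th cohomology of the complex of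
   graded homomorphisms from a projective resolution of L to M; it does not
   depend on the choice of the resolution. *)
Definition ext_neq0 (n : nat) (L M : grmod) : Prop :=
  exists (P : resolution L) (f : 'Hom(P n, M)), cocycle f /\ ~ coboundary f.

Definition koszul : Prop :=
  graded_algebra Cn /\
  forall (L L' : grmod) (n : nat) (r : int),
    irreducible L -> in_grade0 L -> irreducible L' -> in_grade0 L' ->
    ext_neq0 n L (shift L' r) -> n%:Z = r.

End Modules.

Section Restriction.
Variables (F : fieldType) (B : falgType F) (A : {aspace B}).
(* algid A, the unit of subvs_of A, is the unit of B when 1 \in A. *)
Hypothesis A1 : 1 \in A.
Variable M : fdmod B.

Definition res_act : 'Hom(subvs_of A, 'End(M)) :=
  (act M \o linfun (vsval : subvs_of A -> B))%VF.

Lemma res_actE (a : subvs_of A) : res_act a = act M (vsval a).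
Proof. by rewrite comp_lfunE lfunE. Qed.

Lemma res_act1 : res_act 1 = \1%VF.
Proof.
rewrite res_actE; have -> : vsval (1 : subvs_of A) = 1; last exact: act1.
by apply/eqP; rewrite [_ == _]algid_eq1.
Qed.

Lemma res_actM (a b : subvs_of A) :
  res_act (a * b) = (res_act a \o res_act b)%VF.
Proof. by rewrite !res_actE -actM. Qed.

Definition restriction : fdmod (subvs_of A) := FdMod res_act1 res_actM.

End Restriction.

Lemma gr_graded (F : fieldType) (B : falgType F) :
  graded_algebra (@gr_piece F B).
Proof.
pose N := \dim {:B}.
have piece0 n : (N <= n)%N -> gr_piece B n = 0%VS.
  by move=> h; rewrite /gr_piece (radpow_nil h) limg0.
have pieceE n u : u \in gr_piece B n -> forall i : 'I_N, i != n :> nat -> gr_fun u i = 0.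
  by case/memv_imgP => x _ -> i ni; rewrite gr_symbolE (negbTE ni).
split.
- exists (iota 0 N); split.
  + exact: iota_uniq.
  + by move=> i; rewrite mem_iota /= add0n -leqNgt => /piece0.
  + apply/eqP; rewrite eqEsubv subvf; apply/subvP => u _.
    have -> : u = \sum_(n <- iota 0 N)
       gr_symbol B n (\sum_(j < N | j == n :> nat) gr_fun u j).
      apply: gr_eq => k.
      rewrite (big_morph (fun v => gr_fun v k) (fun a b => gr_funD a b k) (gr_fun0 k)).
      rewrite (bigD1_seq (val k)) /= ?iota_uniq ?mem_iota ?ltn_ord //.
      rewrite [X in _ + X]big1 ?addr0 => [|i ni]; last first.
        by rewrite gr_symbolE eq_sym (negbTE ni).
      rewrite gr_symbolE eqxx (big_pred1 k) //.
      by rewrite gr_sigma_id // gr_funW.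
    elim: (iota 0 N) => [|n s IH]; first by rewrite !big_nil mem0v.
    rewrite !big_cons memv_add // /gr_piece memv_img //.
    by apply: memv_suml => j /eqP <-; rewrite gr_funR.
  + have -> : iota 0 N = index_iota 0 N by rewrite /index_iota subn0.
    rewrite directvE /= !big_mkord -directvE /=; apply/directv_sum_independent.
    move=> us uin us0 i _; apply: gr_eq => k; rewrite gr_fun0.
    have [ik|nik] := eqVneq (k : nat) i; last by rewrite (pieceE i) // uin.
    have := congr1 (fun v => gr_fun v k) us0.
    rewrite (big_morph (fun v => gr_fun v k) (fun a b => gr_funD a b k) (gr_fun0 k)).
    rewrite gr_fun0 (bigD1 i) //= big1 ?addr0 // => j nj.
    by rewrite (pieceE j) ?uin // ik eq_sym.
- by rewrite -gr_symbol1; apply: memv_img; apply: memvf.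
- move=> m n; apply/prodvP => _ _ /memv_imgP[x xm ->] /memv_imgP[y yn ->].
  by rewrite gr_symbolM // memv_img // radpowM.
Qed.

(* Main.v *)
Require Import Defs.
From HB Require Import structures.
From mathcomp Require Import all_boot all_order all_algebra all_field.
From mathcomp Require Import boolp.

Set Implicit Arguments.
Unset Strict Implicit.
Unset Printing Implicit Defensive.

Import GRing.Theory Num.Theory.
Local Open Scope ring_scope.

(** Write [C = gr B] and let [A] be the Koszul subalgebra.

    The vanishing of [ext^1] over [A] outside of degree 1 lets one extend morphisms
    from the kernel of a map onto a module in grade 0 ([ext_linear_extend]).  In
    degree 0 this makes all modules in grade 0 semisimple ([complemented_all]); in
    degrees [r >= 2] it shows that [A] is generated in degrees 0 and 1
    ([piece_decomposable]).  Hence the radical of [A] is its positive part and [A] is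
    graded by its radical filtration ([koszul_radpow]), and the vanishing of [ext^n]
    off the diagonal extends from irreducible modules to all modules in grade 0
    ([ext_linear_grade0]); the latter needs additivity of [ext] in both arguments,
    that is, resolutions and their comparison ([ext_linear_suml]).

    Sending [a] in degree [n] to its class in [rad ^ n B / rad ^ n.+1 B] makes [C] a graded
    extension of [A].  The hypothesis on radicals gives [rad ^ n B = (rad A) ^ n B], so
    [C_n = A_n C] ([gr_generated]) and therefore [C_+ M = A_+ M] for every [C]-module [M].  A
    presentation of [B] as a direct summand of a free [A]-module respects the radical
    filtrations, and its associated graded presentation shows that [C] is graded
    projective over [A] ([gr_extension_basis]).

    Now let [P] be any graded projective resolution over [C] of a module in grade 0,
    and let [f] be a cocycle on [P_n] with values in [L'(r)], where [n <> r].  Restricted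
    to [A], [P] is still a projective resolution and [f] is still a cocycle, so that
    [f = g \o d] for some [A]-linear [g].  As [g] kills [A_+ P_(n-1) = C_+ P_(n-1)], and as the
    image of [d] has a complement in [P_(n-1)] modulo [C_+ P_(n-1)] because [B / rad B] is
    semisimple ([gr_complement]), [g] can be replaced by a [C]-linear map
    ([extend_linear]).  Hence [f] is a coboundary. *)

(** * Linear maps, extremal subspaces and gradings *)

Lemma linfun_linear (F : fieldType) (V W : vectType F) (f : V -> W) :
  linear f -> forall x, linfun f x = f x.
Proof.
move=> lf; pose g : {linear V -> W} := HB.pack f (GRing.isLinear.Build F V W _ f lf).
exact: (lfunE g).
Qed.

Section LinearAlgebra.
Variable F : fieldType.

Lemma ex_max_vspace (V : vectType F) (P : {vspace V} -> Prop) U0 : P U0 ->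
  exists2 U, P U & forall U', P U' -> (U <= U')%VS -> U' = U.
Proof.
move=> P0; pose good k := `[< exists U, P U /\ \dim U = k >].
have g0 : exists k, good k by exists (\dim U0); apply/asboolP; exists U0.
have gb k : good k -> (k <= \dim {:V})%N.
  by move/asboolP => [U [_ <-]]; rewrite dimvS ?subvf.
case: (ex_maxnP g0 gb) => k /asboolP[U [PU dU]] maxk.
exists U => // U' PU' s; apply/eqP; rewrite eq_sym eqEdim s dU maxk //.
by apply/asboolP; exists U'.
Qed.

Lemma ex_min_vspace (V : vectType F) (P : {vspace V} -> Prop) U0 : P U0 ->
  exists2 U, P U & forall U', P U' -> (U' <= U)%VS -> U' = U.
Proof.
move=> P0; pose good k := `[< exists U, P U /\ \dim U = k >].
have g0 : exists k, good k by exists (\dim U0); apply/asboolP; exists U0.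
case: (ex_minnP g0) => k /asboolP[U [PU dU]] mink.
exists U => // U' PU' s; apply/eqP; rewrite eqEdim s dU mink //.
by apply/asboolP; exists U'.
Qed.

Section Projections.
Variables (V : vectType F) (I : eqType) (W : I -> {vspace V}).

(** Gradings are handled through their homogeneous projections: compatibility with
    a grading is then an equation between linear maps. *)
Definition projectors (p : I -> 'End(V)) : Prop :=
  [/\ forall i x, p i x \in W i, forall i x, x \in W i -> p i x = x &
      forall i j x, x \in W j -> i != j -> p i x = 0].

Lemma decomposition_of_projectors (p : I -> 'End(V)) (s : seq I) :
    projectors p -> uniq s -> (forall i, i \notin s -> W i = 0%VS) ->
    (forall x, \sum_(i <- s) p i x = x) ->
  decomposition W.
Proof.
move=> [pW pid p0] us W0 psum; exists s; split => //.
  apply/eqP; rewrite eqEsubv subvf; apply/subvP => x _; rewrite -(psum x).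
  elim: (s) => [|i t IH]; first by rewrite !big_nil mem0v.
  by rewrite !big_cons memv_add.
rewrite directvE /=; apply/eqP.
elim: (s) us => [|i t IH] /=; first by rewrite !big_nil dimv0.
case/andP => it ut; rewrite !big_cons -IH // dimv_disjoint_sum //.
apply/eqP; rewrite -subv0; apply/subvP => x; rewrite memv_cap memv0 => /andP[xi xt].
rewrite -(pid i x xi); suff : forall y, y \in (\sum_(j <- t) W j)%VS -> p i y = 0.
  by move=> ->.
elim: (t) it => [|j u IHu]; first by rewrite big_nil => _ y; rewrite memv0 => /eqP ->; rewrite linear0.
rewrite inE negb_or => /andP[ij iu] y; rewrite big_cons.
by case/memv_addP => a aj [b bu ->]; rewrite linearD /= (p0 _ _ _ aj) // add0r IHu.
Qed.

Lemma ex_projectors : decomposition W ->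
  exists p, projectors p /\
    exists s : seq I, [/\ uniq s, forall i, i \notin s -> W i = 0%VS &
      forall x, \sum_(i <- s) p i x = x].
Proof.
case=> s [us W0 sf sd].
pose R i := (\sum_(j <- s | j != i) W j)%VS.
have split_i i : i \in s -> (W i + R i = fullv)%VS.
  by move=> si; rewrite -sf (bigD1_seq i).
have dir_i i : i \in s -> (W i :&: R i = 0)%VS.
  move=> si; apply/eqP; rewrite -dimv_eq0 -(eqn_add2l (\dim (W i + R i))) addn0.
  rewrite dimv_sum_cap split_i // -sf; move: (sd); rewrite directvE /= => /eqP ->.
  rewrite (bigD1_seq i) //= eqn_add2l eqn_leq dimv_leq_sum /=.
  have := dimv_sum_cap (W i) (R i); rewrite split_i // -sf.
  move: (sd); rewrite directvE /= => /eqP ->; rewrite (bigD1_seq i) //= => e.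
  by rewrite -(leq_add2l (\dim (W i))) -e leq_addr.
pose p i : 'End(V) := if i \in s then daddv_pi (W i) (R i) else 0.
have pW i x : p i x \in W i.
  by rewrite /p; case: ifP => _; rewrite ?memv_pi // zero_lfunE mem0v.
have pid i x : x \in W i -> p i x = x.
  rewrite /p; case: ifPn => [si xi | /W0 -> ]; first by rewrite daddv_pi_id ?dir_i.
  by rewrite memv0 => /eqP ->; rewrite linear0.
have p0 i j x : x \in W j -> i != j -> p i x = 0.
  move=> xj ij; rewrite /p; case: ifPn => [si|_]; last by rewrite zero_lfunE.
  have [sj|/W0 e] := boolP (j \in s); last first.
    by move: xj; rewrite e memv0 => /eqP ->; rewrite linear0.
  have xR : x \in R i.
    rewrite /R -big_filter (bigD1_seq j) ?filter_uniq ?mem_filter 1?eq_sym ?ij //=.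
    by apply: (subvP (addvSl _ _)).
  have xs : x \in (W i + R i)%VS by rewrite split_i ?memvf.
  have := daddv_pi_add (dir_i i si) xs.
  have -> : daddv_pi (R i) (W i) x = x by rewrite daddv_pi_id // capvC dir_i.
  by move/(canRL (addrK x)) => ->; rewrite subrr.
exists p; split=> //; exists s; split=> // x.
have : x \in (\sum_(i <- s) W i)%VS by rewrite sf memvf.
elim: (s) us x => [|i t IH] /=; first by rewrite !big_nil => _ x; rewrite big_nil memv0 => /eqP ->.
case/andP=> it ut x; rewrite !big_cons => /memv_addP[a ai [b bt ->]].
rewrite linearD /= pid // -addrA; congr (_ + _).
have -> : p i b = 0.
  elim: (t) it b bt => [|j u IHu]; first by rewrite big_nil => _ b; rewrite memv0 => /eqP ->; rewrite linear0.
  rewrite inE negb_or => /andP[ij iu] b; rewrite big_cons.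
  by case/memv_addP => c cj [d du ->]; rewrite linearD /= (p0 _ _ _ cj) // add0r IHu.
rewrite add0r -[RHS](IH ut b bt) [LHS]big_seq [RHS]big_seq; apply: eq_bigr => j jt.
by rewrite linearD /= (p0 j i a) ?add0r //; apply: contraNneq it => <-.
Qed.

Section Dproj.
Hypothesis dW : decomposition W.

Definition dproj : I -> 'End(V) := projT1 (cid (ex_projectors dW)).

Lemma dproj_projectors : projectors dproj.
Proof. by rewrite /dproj; case: cid => p []. Qed.

Lemma dproj_in i x : dproj i x \in W i.
Proof. by case: dproj_projectors. Qed.

Lemma dproj_id i x : x \in W i -> dproj i x = x.
Proof. by case: dproj_projectors => _ h _; apply: h. Qed.

Lemma dproj_out i j x : x \in W j -> i != j -> dproj i x = 0.
Proof. by case: dproj_projectors => _ _ h; apply: h. Qed.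

Lemma dproj_proj i j x : dproj i (dproj j x) = if i == j then dproj j x else 0.
Proof.
by case: eqP => [->|/eqP n]; [rewrite dproj_id ?dproj_in | rewrite (dproj_out (dproj_in j x))].
Qed.

Lemma dproj_support :
  exists s : seq I, [/\ uniq s, forall i, i \notin s -> W i = 0%VS &
      forall x, \sum_(i <- s) dproj i x = x].
Proof. by rewrite /dproj; case: cid => p []. Qed.

(** Statements that are additive in [x] need only be checked on homogeneous [x]. *)
Lemma homogeneous_ind (P : V -> Prop) :
  P 0 -> (forall x y, P x -> P y -> P (x + y)) -> (forall i x, x \in W i -> P x) ->
  forall x, P x.
Proof.
move=> P0 PD PW x; have [s [_ _ /(_ x) <-]] := dproj_support.
by apply: (big_ind P) => // i _; apply: PW (dproj_in i x).
Qed.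

Lemma dproj_eq0 x : (forall i, dproj i x = 0) -> x = 0.
Proof.
by move=> h; have [s [_ _ /(_ x) <-]] := dproj_support; apply: big1 => i _; rewrite h.
Qed.

End Dproj.
End Projections.
End LinearAlgebra.

Section DprojSum.
Variables (F : fieldType) (V : vectType F) (I : eqType) (W : I -> {vspace V}).
Hypothesis dW : decomposition W.

(** The list of degrees used for summing need only contain the support. *)
Lemma dproj_sum (t : seq I) x : uniq t -> (forall i, i \notin t -> W i = 0%VS) ->
  \sum_(i <- t) dproj dW i x = x.
Proof.
move=> ut t0; apply/eqP; rewrite -subr_eq0; apply/eqP; apply: (dproj_eq0 (dW := dW)) => j.
rewrite linearB linear_sum /=; have [jt|/t0 Wj] := boolP (j \in t).
  rewrite (bigD1_seq j) //= big1 => [|i ij]; last by rewrite dproj_proj eq_sym (negbTE ij).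
  by rewrite dproj_proj eqxx addr0 subrr.
have z y : dproj dW j y = 0.
  by have := dproj_in dW j y; rewrite Wj memv0 => /eqP.
by rewrite z subr0 big1.
Qed.

End DprojSum.

(** * Graded algebras and graded modules *)

Section Actions.
Variables (F : fieldType) (C : falgType F).

Lemma act_mul (M : fdmod C) a b (x : M) : act M (a * b) x = act M a (act M b x).
Proof. by rewrite actM comp_lfunE. Qed.

Lemma act_one (M : fdmod C) (x : M) : act M 1 x = x.
Proof. by rewrite act1 id_lfunE. Qed.

Lemma act_addl (M : fdmod C) a b (x : M) : act M (a + b) x = act M a x + act M b x.
Proof. by rewrite linearD add_lfunE. Qed.

Lemma act_scalel (M : fdmod C) k a (x : M) : act M (k *: a) x = k *: act M a x.
Proof. by rewrite linearZ scale_lfunE. Qed.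

Lemma act_zerol (M : fdmod C) (x : M) : act M 0 x = 0.
Proof. by rewrite linear0 zero_lfunE. Qed.

Lemma act_suml (M : fdmod C) J (r : seq J) (P : pred J) (a : J -> C) (x : M) :
  act M (\sum_(j <- r | P j) a j) x = \sum_(j <- r | P j) act M (a j) x.
Proof. by rewrite linear_sum sum_lfunE. Qed.

Definition mkact (V : vectType F) (a : C -> V -> V) : 'Hom(C, 'End(V)) :=
  linfun (fun c => linfun (a c)).

Lemma mkactE (V : vectType F) (a : C -> V -> V) c x :
  (forall c, linear (a c)) -> (forall x, linear (a^~ x)) -> mkact a c x = a c x.
Proof.
move=> lr ll; have l2 : linear (fun b => linfun (a b)).
  by move=> k u v; apply/lfunP => y; rewrite add_lfunE scale_lfunE !(linfun_linear (lr _)) ll.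
by rewrite /mkact (linfun_linear l2) (linfun_linear (lr c)).
Qed.

Lemma mkact1 (V : vectType F) (a : C -> V -> V) :
  (forall c, linear (a c)) -> (forall x, linear (a^~ x)) ->
  (forall x, a 1 x = x) -> mkact a 1 = \1%VF.
Proof. by move=> lr ll a1; apply/lfunP => x; rewrite mkactE // a1 id_lfunE. Qed.

Lemma mkactM (V : vectType F) (a : C -> V -> V) :
  (forall c, linear (a c)) -> (forall x, linear (a^~ x)) ->
  (forall b c x, a (b * c) x = a b (a c x)) ->
  forall b c, mkact a (b * c) = (mkact a b \o mkact a c)%VF.
Proof. by move=> lr ll aM b c; apply/lfunP => x; rewrite comp_lfunE !mkactE. Qed.

Section RegularModule.

Lemma regular_linr (c : C) : linear (fun x : C => c * x).
Proof. by move=> k x y; rewrite mulrDr scalerAr. Qed.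

Lemma regular_linl (x : C) : linear (fun c : C => c * x).
Proof. by move=> k b c; rewrite mulrDl scalerAl. Qed.

Definition regular : fdmod C :=
  FdMod (mkact1 regular_linr regular_linl (@mul1r C))
        (mkactM regular_linr regular_linl (fun b c x => esym (mulrA b c x))).

Lemma regular_actE (c x : C) : act regular c x = c * x.
Proof. exact: mkactE regular_linr regular_linl. Qed.

End RegularModule.

Section FreeModule.
Variable I : finType.

Definition free_act (c : C) (f : {ffun I -> C}) : {ffun I -> C} := [ffun i => c * f i].

Lemma free_linr c : linear (free_act c).
Proof. by move=> k f g; apply/ffunP => i; rewrite !ffunE mulrDr scalerAr. Qed.

Lemma free_linl f : linear (free_act^~ f).
Proof. by move=> k b c; apply/ffunP => i; rewrite !ffunE mulrDl scalerAl. Qed.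

Lemma free_act_one f : free_act 1 f = f.
Proof. by apply/ffunP => i; rewrite ffunE mul1r. Qed.

Lemma free_act_mul b c f : free_act (b * c) f = free_act b (free_act c f).
Proof. by apply/ffunP => i; rewrite !ffunE mulrA. Qed.

Definition free_mod : fdmod C :=
  @FdMod _ _ ({ffun I -> C} : vectType F) _ (mkact1 free_linr free_linl free_act_one)
        (mkactM free_linr free_linl free_act_mul).

Lemma free_actE c (f : free_mod) i : (act free_mod c f : {ffun I -> C}) i = c * (f : {ffun I -> C}) i.
Proof. by rewrite [act _ _ _](mkactE _ _ free_linr free_linl) ffunE. Qed.

Definition free_coord (i : I) : 'Hom(free_mod, C) :=
  linfun (fun f : {ffun I -> C} => f i : C).

Lemma free_coordE i (f : free_mod) : free_coord i f = (f : {ffun I -> C}) i.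
Proof. by apply: linfun_linear => k u v; rewrite !ffunE. Qed.

Definition free_lift (M : fdmod C) (x : I -> M) : 'Hom(free_mod, M) :=
  linfun (fun f : {ffun I -> C} => \sum_i act M (f i) (x i)).

Lemma free_liftE (M : fdmod C) (x : I -> M) (f : free_mod) :
  free_lift x f = \sum_i act M ((f : {ffun I -> C}) i) (x i).
Proof.
apply: linfun_linear => k u v; rewrite scaler_sumr -big_split /=.
by apply: eq_bigr => i _; rewrite !ffunE act_addl act_scalel.
Qed.

Lemma free_lift_hom (M : fdmod C) (x : I -> M) : module_hom (free_lift x).
Proof.
move=> c f; rewrite !free_liftE linear_sum; apply: eq_bigr => i _.
by rewrite free_actE act_mul.
Qed.

End FreeModule.
End Actions.

Section GradedModules.
Variables (F : fieldType) (C : falgType F) (Cn : nat -> {vspace C}).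

(** Degrees of algebra elements are extended to the integers, where degrees of
    module elements can be subtracted from them. *)
Definition intpiece (k : int) : {vspace C} := if k is Posz n then Cn n else 0%VS.

Lemma intpiece_decomposition : decomposition Cn -> decomposition intpiece.
Proof.
move=> dC; pose p k : 'End(C) := if k is Posz n then dproj dC n else 0.
have [s [us s0 sp]] := dproj_support dC.
apply: (@decomposition_of_projectors _ _ _ _ p [seq Posz n | n <- s]).
- split=> [[n|n] x|[n|n] x|[n|n] [m|m] x] /=.
  + exact: dproj_in.
  + by rewrite zero_lfunE mem0v.
  + exact: dproj_id.
  + by rewrite memv0 => /eqP ->; rewrite zero_lfunE.
  + by move=> xm nm; apply: (dproj_out dC xm); apply: contraNneq nm => ->.
  + by rewrite memv0 => /eqP ->; rewrite linear0.
  + by rewrite zero_lfunE.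
  + by rewrite zero_lfunE.
- by rewrite map_inj_uniq // => m n [].
- by case=> n //= ns; apply: s0; apply: contra ns => h; apply: map_f.
- by move=> x; rewrite big_map; apply: sp.
Qed.

Hypothesis gC : graded_algebra Cn.

Lemma intpiece_graded : decomposition intpiece.
Proof. by apply: intpiece_decomposition; case: gC. Qed.

Let dC := intpiece_graded.

Definition cpi (k : int) : 'End(C) := dproj dC k.

Lemma intpiece1 : 1 \in intpiece 0.
Proof. by case: gC. Qed.

Lemma intpieceM i j a b :
  a \in intpiece i -> b \in intpiece j -> a * b \in intpiece (i + j).
Proof.
case: i => i /= ai; last by move: ai; rewrite memv0 => /eqP -> _; rewrite mul0r mem0v.
case: j => j /= bj; last by move: bj; rewrite memv0 => /eqP ->; rewrite mulr0 mem0v.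
by case: gC => _ _ /(_ i j) /prodvP; apply.
Qed.

Lemma act_piece (M : grmod Cn) i j c (x : M) :
  c \in intpiece i -> x \in piece M j -> act M c x \in piece M (i + j).
Proof.
case: i => i /= ci xj; first exact: piece_act.
by move: ci; rewrite memv0 => /eqP ->; rewrite act_zerol mem0v.
Qed.

Definition gpi (M : grmod Cn) (k : int) : 'End(M) := dproj (piece_decomposition M) k.

Lemma gpi_act (M : grmod Cn) i k c (x : M) :
  c \in intpiece i -> gpi M (i + k) (act M c x) = act M c (gpi M k x).
Proof.
move=> ci; elim/(homogeneous_ind (piece_decomposition M)): x => [|x y|j x xj].
- by rewrite !linear0.
- by move=> ex ey; rewrite !linearD /= ex ey.
rewrite /gpi; have [<-|kj] := eqVneq j k.
  by rewrite !dproj_id // act_piece.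
have cx := act_piece ci xj.
rewrite (dproj_out _ cx) ?(dproj_out _ xj) 1?eq_sym ?linear0 //.
by rewrite (inj_eq (addrI i)).
Qed.

Lemma cpi_mul i k a b : a \in intpiece i -> cpi (i + k) (a * b) = a * cpi k b.
Proof.
move=> ai; elim/(homogeneous_ind dC): b => [|x y|j x xj].
- by rewrite !(linear0, mulr0).
- by move=> ex ey; rewrite mulrDr !linearD /= mulrDr ex ey.
rewrite /cpi; have [<-|kj] := eqVneq j k.
  by rewrite !dproj_id // intpieceM.
have ax := intpieceM ai xj.
rewrite (dproj_out _ ax) ?(dproj_out _ xj) 1?eq_sym ?mulr0 //.
by rewrite (inj_eq (addrI i)).
Qed.

Lemma graded_hom_gpi (M N : grmod Cn) (f : 'Hom(M, N)) k x :
  graded_hom f -> f (gpi M k x) = gpi N k (f x).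
Proof.
move=> [_ fp]; elim/(homogeneous_ind (piece_decomposition M)): x => [|x y|j x xj].
- by rewrite !linear0.
- by move=> ex ey; rewrite !linearD /= ex ey.
have fx : f x \in piece N j by apply: (subvP (fp j)); apply: memv_img.
rewrite /gpi; have [<-|kj] := eqVneq j k; first by rewrite !dproj_id.
by rewrite (dproj_out _ xj) 1?eq_sym // (dproj_out _ fx) 1?eq_sym // linear0.
Qed.

Lemma graded_homP (M N : grmod Cn) (f : 'Hom(M, N)) :
  graded_hom f <-> module_hom f /\
    forall k x, x \in piece M k -> f x \in piece N k.
Proof.
split=> [[fh fp] | [fh fp]]; split=> //.
  by move=> k x xk; apply: (subvP (fp k)); apply: memv_img.
by move=> k; apply/subvP => _ /memv_imgP[x xk ->]; apply: fp.
Qed.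

Lemma graded_hom_comp (M N P : grmod Cn) (g : 'Hom(N, P)) (f : 'Hom(M, N)) :
  graded_hom g -> graded_hom f -> graded_hom (g \o f)%VF.
Proof.
move=> /graded_homP[gh gp] /graded_homP[fh fp]; apply/graded_homP; split.
  by move=> c x; rewrite !comp_lfunE fh gh.
by move=> k x xk; rewrite comp_lfunE gp ?fp.
Qed.

Lemma graded_hom_id (M : grmod Cn) : graded_hom (\1%VF : 'Hom(M, M)).
Proof.
by apply/graded_homP; split=> [c x | k x]; rewrite !id_lfunE.
Qed.

Lemma graded_hom_zero (M N : grmod Cn) : graded_hom (0 : 'Hom(M, N)).
Proof.
by apply/graded_homP; split=> [c x | k x]; rewrite !zero_lfunE ?linear0 ?mem0v.
Qed.

Lemma graded_hom_add (M N : grmod Cn) (f g : 'Hom(M, N)) :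
  graded_hom f -> graded_hom g -> graded_hom (f + g).
Proof.
move=> /graded_homP[fh fp] /graded_homP[gh gp]; apply/graded_homP; split.
  by move=> c x; rewrite !add_lfunE fh gh linearD.
by move=> k x xk; rewrite add_lfunE memvD ?fp ?gp.
Qed.

Lemma graded_hom_opp (M N : grmod Cn) (f : 'Hom(M, N)) :
  graded_hom f -> graded_hom (- f).
Proof.
move=> /graded_homP[fh fp]; apply/graded_homP; split.
  by move=> c x; rewrite !opp_lfunE fh linearN.
by move=> k x xk; rewrite opp_lfunE memvN fp.
Qed.

(** * Graded projective modules *)

Section FreeGraded.
Variables (I : finType) (d : I -> int).

Definition free_piece (k : int) : {vspace free_mod C I} :=
  vspaceof (fun f : {ffun I -> C} => forall i, f i \in intpiece (k - d i)).

Lemma mem_free_piece k (f : free_mod C I) :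
  f \in free_piece k <-> forall i, (f : {ffun I -> C}) i \in intpiece (k - d i).
Proof.
apply: (@mem_vspaceof F ({ffun I -> C} : vectType F)) => [i|c u v hu hv i].
  by rewrite ffunE mem0v.
by rewrite !ffunE memvD ?memvZ.
Qed.

Lemma free_decomposition : decomposition free_piece.
Proof.
pose pf k (f : {ffun I -> C}) : {ffun I -> C} := [ffun i => cpi (k - d i) (f i)].
have pl k : linear (pf k).
  by move=> c u v; apply/ffunP => i; rewrite !ffunE linearP.
pose p k : 'End(free_mod C I) := linfun (pf k).
have pE k f i : (p k f : {ffun I -> C}) i = cpi (k - d i) ((f : {ffun I -> C}) i).
  by rewrite [p k f](linfun_linear (pl k)) ffunE.
have [sC [usC sC0 _]] := dproj_support dC.
pose s := undup [seq k + d i | k <- sC, i <- enum I].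
apply: (@decomposition_of_projectors _ _ _ _ p s).
- split=> [k x|k x /mem_free_piece xk|k j x /mem_free_piece xj kj].
  + by apply/mem_free_piece => i; rewrite pE dproj_in.
  + by apply/ffunP => i; rewrite pE dproj_id.
  + apply/ffunP => i; rewrite pE ffunE (dproj_out _ (xj i)) //.
    by rewrite (inj_eq (addIr _)).
- exact: undup_uniq.
- move=> k ks; apply/eqP; rewrite -subv0; apply/subvP => f /mem_free_piece fk.
  rewrite memv0; apply/eqP/ffunP => i; rewrite ffunE; apply/eqP; rewrite -memv0.
  rewrite -(sC0 (k - d i)) //; apply: contra ks => h; rewrite mem_undup.
  by apply/allpairsP; exists (k - d i, i); rewrite /= h mem_enum subrK.
- move=> f; apply/ffunP => i; rewrite sum_ffunE.
  transitivity (\sum_(k <- [seq k - d i | k <- s]) cpi k ((f : {ffun I -> C}) i)).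
    by rewrite big_map; apply: eq_bigr => k _; rewrite pE.
  apply: dproj_sum; first by rewrite map_inj_uniq ?undup_uniq //; apply: addIr.
  move=> k; apply: contraNeq => Wk; apply/mapP; exists (k + d i); last by rewrite addrK.
  rewrite mem_undup; apply/allpairsP; exists (k, i); split=> //=; last by rewrite mem_enum.
  by apply: contraNT Wk => /sC0 ->.
Qed.

Lemma free_piece_act (i : nat) j (c : C) (x : free_mod C I) :
  c \in Cn i -> x \in free_piece j -> act (free_mod C I) c x \in free_piece (i%:Z + j).
Proof.
move=> ci /mem_free_piece xj; apply/mem_free_piece => l.
by rewrite free_actE -addrA; apply: intpieceM.
Qed.

Definition free_gr : grmod Cn := GrMod free_decomposition free_piece_act.

Lemma free_lift_graded (M : grmod Cn) (x : I -> M) :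
  (forall i, x i \in piece M (d i)) -> graded_hom (free_lift x : 'Hom(free_gr, M)).
Proof.
move=> xd; apply/graded_homP; split; first exact: free_lift_hom.
move=> k f /mem_free_piece fk; rewrite free_liftE; apply: memv_suml => i _.
by rewrite -(subrK (d i) k) act_piece.
Qed.

End FreeGraded.

(** A graded module is projective exactly when it is a graded direct summand of a
    graded free module; the coordinates of such a presentation form a dual
    basis, a notion that is inherited by composition of ring extensions. *)
Definition graded_dual_basis (P : grmod Cn) : Prop :=
  exists (I : finType) (d : I -> int) (x : I -> P) (f : I -> 'Hom(P, C)),
  [/\ forall i, x i \in piece P (d i),
      forall i c y, f i (act P c y) = c * f i y,
      forall i k y, y \in piece P k -> f i y \in intpiece (k - d i) &
      forall y, \sum_i act P (f i y) (x i) = y].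

Lemma free_dual_basis (I : finType) (d : I -> int) : graded_dual_basis (free_gr d).
Proof.
exists I, d, (fun i => [ffun j => if j == i then 1 else 0]), (@free_coord _ _ _).
split=> [i|i c y|i k y /mem_free_piece|y].
- apply/mem_free_piece => j; rewrite ffunE; case: eqP => [->|_]; last exact: mem0v.
  by rewrite subrr intpiece1.
- by rewrite !free_coordE free_actE.
- by rewrite free_coordE; apply.
apply/ffunP => j; rewrite sum_ffunE (bigD1 j) //= big1 => [|i ij].
  by rewrite addr0 free_coordE [LHS]free_actE ffunE eqxx mulr1.
by rewrite [LHS]free_actE ffunE eq_sym (negbTE ij) mulr0.
Qed.

(** Homogeneous lifts of the images of the dual basis exist because the
    homogeneous component of any lift is again a lift. *)
Lemma dual_basis_lift (P M N : grmod Cn) (g : 'Hom(M, N)) (f : 'Hom(P, N)) :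
    graded_dual_basis P -> graded_hom g -> graded_hom f ->
    (forall x, f x \in limg g) ->
  exists2 h : 'Hom(P, M), graded_hom h & forall x, g (h x) = f x.
Proof.
move=> [I [d [x [c [xd cl cd cx]]]]] gg gf fg.
have [gh _] := gg; have [fh fp] := (graded_homP f).1 gf.
pose z i := gpi M (d i) (g^-1%VF (f (x i))).
have zP i : g (z i) = f (x i).
  rewrite graded_hom_gpi // limg_lfunVK // /gpi dproj_id //.
  exact: fp.
pose hf (y : P) : M := \sum_i act M (c i y) (z i).
have hl : linear hf.
  move=> k u v; rewrite scaler_sumr -big_split /=; apply: eq_bigr => i _.
  by rewrite linearP act_addl act_scalel.
exists (linfun hf) => [|y]; rewrite ?linfun_linear //.
  apply/graded_homP; split=> [b y|k y yk]; rewrite !(linfun_linear hl).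
    by rewrite linear_sum; apply: eq_bigr => i _; rewrite cl act_mul.
  apply: memv_suml => i _; rewrite -(subrK (d i) k); apply: act_piece; first exact: cd.
  exact: dproj_in.
rewrite /hf linear_sum -{2}(cx y) linear_sum /=; apply: eq_bigr => i _.
by rewrite gh fh zP.
Qed.

Lemma dual_basis_projective (P : grmod Cn) :
  graded_dual_basis P -> graded_projective P.
Proof.
move=> dP M N g f gg gs gf.
have [|h hg hf] := dual_basis_lift dP gg gf; first by move=> x; rewrite gs memvf.
by exists h => //; apply/lfunP => x; rewrite comp_lfunE.
Qed.

Definition graded_sub (M : grmod Cn) (N : {vspace M}) : Prop :=
  forall k x, x \in N -> gpi M k x \in N.

(** The homogeneous components of a basis of [N] generate [N]. *)
Lemma ex_free_cover (M : grmod Cn) (N : {vspace M}) :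
    submodule N -> graded_sub N ->
  exists (P : grmod Cn) (g : 'Hom(P, M)),
    [/\ graded_dual_basis P, graded_hom g & limg g = N].
Proof.
move=> sN gN; have [s [us _ ps]] := dproj_support (piece_decomposition M).
pose I := ('I_(size s) * 'I_(\dim N))%type.
pose d (i : I) := nth 0 s i.1.
pose x (i : I) : M := gpi M (d i) (vbasis N)`_i.2.
exists (free_gr d), (free_lift x); split.
- exact: free_dual_basis.
- by apply: free_lift_graded => i; apply: dproj_in.
apply/eqP; rewrite eqEsubv; apply/andP; split; apply/subvP => y.
  case/memv_imgP => f _ ->; rewrite free_liftE; apply: memv_suml => i _.
  by apply/sN/gN/vbasis_mem; rewrite mem_nth // size_tuple.
move=> yN; apply/memv_imgP.
exists ([ffun i : I => (coord (vbasis N) i.2 y)%:A] : {ffun I -> C}); first exact: memvf.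
rewrite free_liftE -[LHS](ps y) [in LHS](coord_vbasis yN).
rewrite (big_nth 0) big_mkord.
transitivity (\sum_(a < size s) \sum_(b < \dim N)
    act M (coord (vbasis N) b y)%:A (gpi M (nth 0 s a) (vbasis N)`_b)).
  apply: eq_bigr => a _; rewrite linear_sum; apply: eq_bigr => b _.
  by rewrite linearZ act_scalel act_one.
by rewrite pair_bigA; apply: eq_bigr => i _; rewrite ffunE.
Qed.


End GradedModules.

(** * Resolutions and additivity of ext *)

Section Resolutions.
Variables (F : fieldType) (C : falgType F) (Cn : nat -> {vspace C}).
Hypothesis gC : graded_algebra Cn.
Implicit Types (L M N : grmod Cn).

Lemma submodule_full (M : fdmod C) : submodule (fullv : {vspace M}).
Proof. by move=> c x _; apply: memvf. Qed.

Lemma graded_sub_full M : graded_sub (fullv : {vspace M}).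
Proof. by move=> k x _; apply: memvf. Qed.

Lemma projective_dual_basis (P : grmod Cn) :
  graded_projective P -> graded_dual_basis P.
Proof.
move=> prP; have [Q [g [dQ gg gs]]] := ex_free_cover gC (@submodule_full P) (@graded_sub_full P).
have [h hg hK] := prP _ _ g _ gg gs (graded_hom_id P).
have ghK y : g (h y) = y by rewrite -comp_lfunE hK id_lfunE.
have [I [d [x [f [xd fl fd fx]]]]] := dQ.
have [/graded_homP[gh gp] /graded_homP[hh hp]] := (gg, hg).
exists I, d, (fun i => g (x i)), (fun i => (f i \o h)%VF); split.
- by move=> i; apply: gp.
- by move=> i c y; rewrite !comp_lfunE hh fl.
- by move=> i k y yk; rewrite comp_lfunE; apply/fd/hp.
move=> y; rewrite -[RHS]ghK -[in RHS](fx (h y)) linear_sum /=.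
by apply: eq_bigr => i _; rewrite gh comp_lfunE.
Qed.

Lemma submodule_ker (M N : fdmod C) (f : 'Hom(M, N)) :
  module_hom f -> submodule (lker f).
Proof. by move=> fh c x; rewrite !memv_ker fh => /eqP ->; rewrite linear0. Qed.

Lemma graded_sub_ker M N (f : 'Hom(M, N)) : graded_hom f -> graded_sub (lker f).
Proof.
by move=> fg k x; rewrite !memv_ker graded_hom_gpi // => /eqP ->; rewrite linear0.
Qed.

(** A stage of the construction of a resolution: a module together with the
    graded submodule that the next term has to cover. *)
Record stage : Type := Stage {
  stage_mod : grmod Cn;
  stage_sub : {vspace stage_mod};
  stage_submodule : submodule stage_sub;
  stage_graded : graded_sub stage_sub
}.

Lemma ex_next_stage (s : stage) : exists t : stage,
  exists g : 'Hom(stage_mod t, stage_mod s),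
  [/\ graded_dual_basis (stage_mod t), graded_hom g, limg g = stage_sub s &
      stage_sub t = lker g].
Proof.
have [P [g [dP gg gs]]] := ex_free_cover gC (@stage_submodule s) (@stage_graded s).
by exists (Stage (submodule_ker gg.1) (graded_sub_ker gg)), g.
Qed.

Definition next_stage s : stage := projT1 (cid (ex_next_stage s)).

Definition next_map s : 'Hom(stage_mod (next_stage s), stage_mod s) :=
  projT1 (cid (projT2 (cid (ex_next_stage s)))).

Lemma next_stageP s :
  [/\ graded_dual_basis (stage_mod (next_stage s)), graded_hom (next_map s),
      limg (next_map s) = stage_sub s & stage_sub (next_stage s) = lker (next_map s)].
Proof. exact: projT2 (cid (projT2 (cid (ex_next_stage s)))). Qed.

Lemma ex_resolution L : exists P : resolution L, True.
Proof.
pose s0 := Stage (@submodule_full L) (@graded_sub_full L).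
pose st n := iter n.+1 next_stage s0.
have P n := next_stageP (iter n next_stage s0).
unshelve eexists (@Resolution _ _ _ L (fun n => stage_mod (st n))
  (fun n => next_map (st n)) (next_map s0) _ _ _ _ _ _) => //.
- by move=> n; apply: dual_basis_projective; have [] := P n.
- by move=> n; have [] := P n.+1.
- by have [] := P 0.
- by have [] := P 0.
- have [_ _ _ <-] := P 0; have [_ _ e _] := P 1; exact: esym e.
- by move=> n; have [_ _ _ <-] := P n.+1; have [_ _ e _] := P n.+2; exact: esym e.
Qed.

Lemma aug_diff L (P : resolution L) x : aug P (diff P 0 x) = 0.
Proof. by apply/eqP; rewrite -memv_ker aug_exact memv_img ?memvf. Qed.

Lemma diff_diff L (P : resolution L) n x : diff P n (diff P n.+1 x) = 0.
Proof. by apply/eqP; rewrite -memv_ker diff_exact memv_img ?memvf. Qed.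

Lemma res_lift L (P : resolution L) n M N (g : 'Hom(M, N)) (f : 'Hom(P n, N)) :
    graded_hom g -> graded_hom f -> (forall x, f x \in limg g) ->
  exists2 h : 'Hom(P n, M), graded_hom h & forall x, g (h x) = f x.
Proof. by apply: dual_basis_lift; apply/projective_dual_basis/res_projective. Qed.

(** The chain map is built by dependent choice on maps that send boundaries to
    boundaries, which is what the next lifting step needs. *)
Lemma ex_chain_map L N (P : resolution L) (Q : resolution N) (h : 'Hom(L, N)) :
    graded_hom h ->
  exists phi : forall n, 'Hom(P n, Q n),
    [/\ forall n, graded_hom (phi n),
        forall x, aug Q (phi 0 x) = h (aug P x) &
        forall n x, diff Q n (phi n.+1 x) = phi n (diff P n x)].
Proof.
move=> gh.
pose good n (p : 'Hom(P n, Q n)) :=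
  graded_hom p /\ forall x, p (diff P n x) \in limg (diff Q n).
have [||p0 gp0 ep0] := @res_lift L P 0 (Q 0) N (aug Q) (h \o aug P)%VF (aug_hom Q).
- by apply: graded_hom_comp gh (aug_hom P).
- by move=> x; rewrite aug_onto memvf.
have good0 : good 0 p0.
  split=> // x; rewrite -aug_exact memv_ker ep0 comp_lfunE aug_diff linear0.
  exact: eqxx.
have step n (p : {p | good n p}) : exists q : 'Hom(P n.+1, Q n.+1),
    good n.+1 q /\ forall x, diff Q n (q x) = sval p (diff P n x).
  case: p => p [gp pd] /=.
  have [||q gq eq] := @res_lift L P n.+1 _ _ (diff Q n) (p \o diff P n)%VF (diff_hom Q n).
  - exact: graded_hom_comp gp (diff_hom P n).
  - by move=> x; rewrite comp_lfunE.
  exists q; split=> [|x]; last by rewrite eq comp_lfunE.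
  split=> // x; rewrite -diff_exact memv_ker eq comp_lfunE diff_diff linear0.
  exact: eqxx.
pose nxt n (p : {p | good n p}) : {p | good n.+1 p} :=
  exist _ (projT1 (cid (step n p))) (projT2 (cid (step n p))).1.
pose phi := fix phi n : {p | good n p} :=
  if n is m.+1 then nxt m (phi m) else exist _ p0 good0.
exists (fun n => sval (phi n)); split=> [n|x|n x].
- by case: (svalP (phi n)).
- by rewrite ep0 comp_lfunE.
by rewrite /=; case: (cid _) => q [].
Qed.

(** A chain endomorphism over the zero map is null-homotopic, so that it
    acts as zero on cohomology.  Only the components [t] and [t'] of the homotopy in
    degrees [n - 1] and [n] enter. *)
Lemma cocycle_comp_null L M (P : resolution L) (th : forall n, 'Hom(P n, P n))
    n (f : 'Hom(P n, M)) :
    (forall n, graded_hom (th n)) -> (forall x, aug P (th 0 x) = 0) ->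
    (forall n x, diff P n (th n.+1 x) = th n (diff P n x)) ->
  cocycle f -> coboundary (f \o th n)%VF.
Proof.
move=> gth th0 thd [gf fd].
have fd0 x : f (diff P n x) = 0 by rewrite -comp_lfunE fd zero_lfunE.
have [t0 gt0 et0] : exists2 t : 'Hom(P 0, P 1), graded_hom t &
    forall x, diff P 0 (t x) = th 0 x.
  apply: res_lift (diff_hom P 0) (gth 0) _ => x.
  by rewrite -aug_exact memv_ker th0.
have step m (t : 'Hom(P m, P m.+1)) : graded_hom t ->
    (forall x, diff P m (th m.+1 x) = diff P m (t (diff P m x))) ->
    exists2 t' : 'Hom(P m.+1, P m.+2), graded_hom t' &
      forall x, diff P m.+1 (t' x) = th m.+1 x - t (diff P m x).
  move=> gt et.
  have [||t' gt' et'] := @res_lift _ _ _ _ _ (diff P m.+1)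
      (th m.+1 - (t \o diff P m)%VF) (diff_hom P m.+1).
  - by apply: graded_hom_add => //; apply/graded_hom_opp/graded_hom_comp/diff_hom.
  - move=> x; rewrite -diff_exact memv_ker add_lfunE opp_lfunE comp_lfunE.
    by rewrite linearB /= et subrr.
  by exists t' => // x; rewrite et' add_lfunE opp_lfunE comp_lfunE.
have htpy m : exists2 t : 'Hom(P m, P m.+1), graded_hom t &
    forall x, diff P m (th m.+1 x) = diff P m (t (diff P m x)).
  elim: m => [|m [t gt et]]; first by exists t0 => // x; rewrite thd et0.
  have [t' gt' et'] := step m t gt et; exists t' => // x.
  by rewrite thd et' diff_diff linear0 subr0.
case: n f gf fd fd0 => [|n] f gf fd fd0 /=.
  by apply/lfunP => x; rewrite comp_lfunE -et0 fd0 zero_lfunE.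
have [t gt et] := htpy n; have [t' gt' et'] := step n t gt et.
exists (f \o t)%VF; first exact: graded_hom_comp.
apply/lfunP => x; rewrite !comp_lfunE.
have -> : th n.+1 x = diff P n.+1 (t' x) + t (diff P n x) by rewrite et' subrK.
by rewrite linearD /= fd0 add0r.
Qed.

Lemma coboundary_add L M (P : resolution L) n (f g : 'Hom(P n, M)) :
  coboundary f -> coboundary g -> coboundary (f + g).
Proof.
case: n f g => [|n] f g /= => [-> ->|[a ga ->] [b gb ->]]; first by rewrite addr0.
by exists (a + b); [exact: graded_hom_add | rewrite comp_lfunDl].
Qed.

Lemma coboundary_comp L M N (P : resolution L) n (f : 'Hom(P n, M)) (g : 'Hom(M, N)) :
  graded_hom g -> coboundary f -> coboundary (g \o f)%VF.
Proof.
move=> gg; case: n f => [|n] f /= => [->|[a ga ->]].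
  by apply/lfunP => x; rewrite comp_lfunE !zero_lfunE linear0.
by exists (g \o a)%VF; [exact: graded_hom_comp | rewrite comp_lfunA].
Qed.

Lemma cocycle_comp L M N (P : resolution L) n (f : 'Hom(P n, M)) (g : 'Hom(M, N)) :
  graded_hom g -> cocycle f -> cocycle (g \o f)%VF.
Proof.
move=> gg [gf fd]; split; first exact: graded_hom_comp.
by rewrite -comp_lfunA fd; apply/lfunP => x; rewrite comp_lfunE !zero_lfunE linear0.
Qed.

Section Pullback.
Variables (L N M : grmod Cn) (P : resolution L) (Q : resolution N).
Variable phi : forall n, 'Hom(P n, Q n).
Hypothesis gphi : forall n, graded_hom (phi n).
Hypothesis phid : forall n x, diff Q n (phi n.+1 x) = phi n (diff P n x).

Lemma coboundary_chain_map n (f : 'Hom(Q n, M)) :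
  coboundary f -> coboundary (f \o phi n)%VF.
Proof.
case: n f => [|n] f /= => [->|[a ga ->]].
  by apply/lfunP => x; rewrite comp_lfunE !zero_lfunE.
exists (a \o phi n)%VF; first exact: graded_hom_comp.
by apply/lfunP => x; rewrite !comp_lfunE phid.
Qed.

Lemma cocycle_chain_map n (f : 'Hom(Q n, M)) : cocycle f -> cocycle (f \o phi n)%VF.
Proof.
move=> [gf fd]; split; first exact: graded_hom_comp.
apply/lfunP => x; rewrite !comp_lfunE -phid -[f _]comp_lfunE fd.
by rewrite !zero_lfunE.
Qed.

End Pullback.

(** Vanishing of [ext^n(L, L'(r))] for [n <> r], on every resolution of [L]. *)
Definition ext_linear (L L' : grmod Cn) : Prop :=
  forall (P : resolution L) n (r : int) (f : 'Hom(P n, shift L' r)),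
    n%:Z <> r -> cocycle f -> coboundary f.

Lemma koszul_ext_linear (L L' : grmod Cn) : koszul Cn ->
  irreducible L -> in_grade0 L -> irreducible L' -> in_grade0 L' -> ext_linear L L'.
Proof.
move=> [_ kC] iL gL iL' gL' P n r f nr cf; apply: contrapT => nb; apply: nr.
by apply: kC iL gL iL' gL' _; exists P, f.
Qed.

Lemma shift_hom (M N : grmod Cn) (f : 'Hom(M, N)) r :
  graded_hom f -> graded_hom (f : 'Hom(shift M r, shift N r)).
Proof. by move=> [fh fp]; split=> // i; apply: fp. Qed.

(** A direct sum decomposition of [M], given by structure maps because these are
    what cocycles are composed with. *)
Definition biproduct (M U V : grmod Cn) (iU : 'Hom(U, M)) (pU : 'Hom(M, U))
    (iV : 'Hom(V, M)) (pV : 'Hom(M, V)) : Prop :=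
  [/\ graded_hom iU, graded_hom pU, graded_hom iV & graded_hom pV] /\
  forall x, iU (pU x) + iV (pV x) = x.

Lemma ext_linear_sumr L M U V iU pU iV pV :
  @biproduct M U V iU pU iV pV -> ext_linear L U -> ext_linear L V -> ext_linear L M.
Proof.
move=> [[giU gpU giV gpV] e] hU hV P n r f nr cf.
have bU : coboundary ((iU : 'Hom(shift U r, shift M r)) \o
    ((pU : 'Hom(shift M r, shift U r)) \o f))%VF.
  by apply: coboundary_comp (shift_hom r giU) _; apply/hU/cocycle_comp/cf/shift_hom.
have bV : coboundary ((iV : 'Hom(shift V r, shift M r)) \o
    ((pV : 'Hom(shift M r, shift V r)) \o f))%VF.
  by apply: coboundary_comp (shift_hom r giV) _; apply/hV/cocycle_comp/cf/shift_hom.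
have := coboundary_add bU bV; congr coboundary.
by apply/lfunP => x; rewrite add_lfunE !comp_lfunE e.
Qed.

(** Additivity in the first argument needs a comparison of the given
    resolution of [M] with resolutions of the summands. *)
Lemma ext_linear_suml L M U V iU pU iV pV :
  @biproduct M U V iU pU iV pV -> ext_linear U L -> ext_linear V L -> ext_linear M L.
Proof.
move=> [[giU gpU giV gpV] e] hU hV P n r f nr cf.
have [[QU _] [QV _]] := (ex_resolution U, ex_resolution V).
have [aU [gaU augU dU]] := ex_chain_map P QU gpU.
have [bU [gbU augU' dU']] := ex_chain_map QU P giU.
have [aV [gaV augV dV]] := ex_chain_map P QV gpV.
have [bV [gbV augV' dV']] := ex_chain_map QV P giV.
pose th n := \1%VF - ((bU n \o aU n)%VF + (bV n \o aV n)%VF) : 'Hom(P n, P n).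
have thE k x : th k x = x - (bU k (aU k x) + bV k (aV k x)).
  by rewrite /th add_lfunE opp_lfunE id_lfunE add_lfunE !comp_lfunE.
have cU : coboundary ((f \o bU n) \o aU n)%VF.
  by apply: (coboundary_chain_map gaU dU); apply: hU nr _; apply: cocycle_chain_map.
have cV : coboundary ((f \o bV n) \o aV n)%VF.
  by apply: (coboundary_chain_map gaV dV); apply: hV nr _; apply: cocycle_chain_map.
have cth : coboundary (f \o th n)%VF.
  apply: cocycle_comp_null cf => [k|x|k x].
  - apply: graded_hom_add; first exact: graded_hom_id.
    by apply/graded_hom_opp/graded_hom_add; apply: graded_hom_comp.
  - by rewrite thE linearB linearD /= augU' augU augV' augV e subrr.
  - by rewrite !thE !linearB !linearD /= dU' dU dV' dV.
have := coboundary_add cth (coboundary_add cU cV); congr coboundary.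
apply/lfunP => x; rewrite !add_lfunE !comp_lfunE thE linearB linearD /=.
by rewrite subrK.
Qed.

Lemma ext_linear_zeror L M : (fullv : {vspace M}) = 0%VS -> ext_linear L M.
Proof.
move=> M0 P n r f _ _; have -> : f = 0; last first.
  by case: n f => [|n] f //=; exists 0; [exact: graded_hom_zero | rewrite comp_lfun0l].
by apply/lfunP => x; apply/eqP; rewrite zero_lfunE -memv0 -M0 memvf.
Qed.

(** Over the zero module the identity is null-homotopic. *)
Lemma ext_linear_zerol L M : (fullv : {vspace M}) = 0%VS -> ext_linear M L.
Proof.
move=> M0 P n r f _ cf.
have : coboundary (f \o \1)%VF; last by rewrite comp_lfun1r.
apply: (@cocycle_comp_null _ _ P (fun n => \1%VF)) => // [k|x|k x].
- exact: graded_hom_id.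
- by apply/eqP; rewrite -memv0 -M0 memvf.
- by rewrite !id_lfunE.
Qed.

End Resolutions.

(** * Extension of morphisms from a kernel *)

Section ExtOne.
Variables (F : fieldType) (C : falgType F) (Cn : nat -> {vspace C}).
Hypothesis gC : graded_algebra Cn.

(** This is the long exact sequence of [ext] at [Hom(ker g, S(r))]: a lift [la] of the
    augmentation of a resolution of [L] through [g] turns [e] into a 1-cocycle, and
    writing it as [t \o d] gives the extension [m |-> e (m - la p) + t p], where
    [p] has the same image in [L] as [m].  The map [e] is given on all of [M], with
    conditions on the kernel of [g], instead of turning the kernel into a module. *)
Lemma ext_linear_extend (L M S : grmod Cn) (g : 'Hom(M, L)) (r : int) (e : 'Hom(M, S)) :
    ext_linear L S -> r <> 1 -> graded_hom g -> limg g = fullv ->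
    (forall c x, x \in lker g -> e (act M c x) = act S c (e x)) ->
    (forall k x, x \in lker g -> x \in piece M k -> e x \in piece S (k - r)) ->
  exists2 e' : 'Hom(M, shift S r), graded_hom e' & forall x, x \in lker g -> e' x = e x.
Proof.
move=> LS r1 gg gs el ep; have [P _] := ex_resolution gC L.
have [|la gla ela] := @res_lift _ _ _ gC L P 0 M L g (aug P) gg (aug_hom P).
  by move=> x; rewrite gs memvf.
have [/graded_homP[gh gp] /graded_homP[lh lp]] := (gg, gla).
have ker_la x : la (diff P 0 x) \in lker g by rewrite memv_ker ela aug_diff.
have [/graded_homP[dh dp] /graded_homP[ah ap]] := (diff_hom P 0, aug_hom P).
pose f : 'Hom(P 1, shift S r) := (e \o (la \o diff P 0))%VF.
have fE x : f x = e (la (diff P 0 x)) by rewrite /f !comp_lfunE.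
have cf : cocycle f.
  split; last by apply/lfunP => x; rewrite comp_lfunE fE diff_diff !linear0 zero_lfunE.
  apply/graded_homP; split=> [c x|k x xk]; first by rewrite !fE dh lh el.
  by rewrite fE; apply: ep => //; apply/lp/dp.
have [t gt ft] : coboundary f by apply: LS cf => /esym.
have ftE x : t (diff P 0 x) = e (la (diff P 0 x)) by rewrite -fE ft comp_lfunE.
have /graded_homP[th tp] := gt.
pose a : 'Hom(M, P 0) := ((aug P)^-1 \o g)%VF.
pose e' : 'Hom(M, shift S r) := (e \o (\1%VF - (la \o a)%VF))%VF + (t \o a)%VF.
(* The choice of [p] does not matter, since [e \o la \o d = t \o d]. *)
have e'E m p : aug P p = g m -> e' m = e (m - la p) + t p.
  move=> pm; have am : aug P (a m) = g m.
    by rewrite comp_lfunE limg_lfunVK // aug_onto memvf.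
  have : p - a m \in lker (aug P) by rewrite memv_ker linearB /= pm am subrr.
  rewrite aug_exact => /memv_imgP[q _ eq].
  have -> : p = a m + diff P 0 q by rewrite -eq addrC subrK.
  rewrite /e' add_lfunE !comp_lfunE add_lfunE opp_lfunE id_lfunE comp_lfunE.
  rewrite (linearD la) (linearD t) /= ftE opprD (addrA m) [e (_ - _ - _)]linearB /=.
  by rewrite [RHS]addrACA addNr addr0 comp_lfunE.
exists e' => [|x]; last first.
  rewrite memv_ker => /eqP gx; have := e'E x 0.
  by rewrite !linear0 !addr0 gx; apply.
have apre m : exists p, aug P p = g m.
  by exists (a m); rewrite comp_lfunE limg_lfunVK // aug_onto memvf.
have ker_sub m p : aug P p = g m -> m - la p \in lker g.
  by move=> pm; rewrite memv_ker linearB /= ela pm subrr.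
apply/graded_homP; split=> [c m|k m mk].
  have [p pm] := apre m; rewrite (e'E _ (act _ c p)) ?ah ?gh ?pm //.
  by rewrite (e'E m p) // lh -linearB el ?ker_sub // th [RHS](linearD (act (shift S r) c)).
have [p0 pm0] := apre m; pose p := gpi (P 0) k p0.
have pm : aug P p = g m.
  by rewrite /p (graded_hom_gpi _ _ (aug_hom P)) pm0 /gpi dproj_id // gp.
have pk : p \in piece (P 0) k by apply: dproj_in.
rewrite (e'E m p) // memvD ?tp //; apply: ep; first exact: ker_sub.
by rewrite memvB // lp.
Qed.

(** * Modules concentrated in grade 0 *)

Definition grade0_piece (V : vectType F) (i : int) : {vspace V} :=
  if i == 0 then fullv else 0%VS.

Lemma grade0_decomposition (V : vectType F) : decomposition (@grade0_piece V).
Proof.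
pose p (i : int) : 'End(V) := if i == 0 then \1%VF else 0.
apply: (@decomposition_of_projectors _ _ _ _ p [:: 0]) => //.
- rewrite /p /grade0_piece; split=> [i x|i x|i j x].
  + by case: eqP => _; rewrite ?memvf ?zero_lfunE ?mem0v.
  + by case: eqP => _; rewrite ?id_lfunE // memv0 zero_lfunE => /eqP.
  + case: (j =P 0) => [->|_]; first by move=> _ /negbTE ->; rewrite zero_lfunE.
    by rewrite memv0 => /eqP -> _; rewrite linear0.
- by move=> i; rewrite inE /grade0_piece => /negbTE ->.
by move=> x; rewrite big_seq1 /p eqxx id_lfunE.
Qed.

(** The quotient [N / X] is carried by a complement of [X] in [N]; the map [e] is the
    projection onto it, and only its restriction to [N] has a meaning. *)
Lemma ex_subquotient (M : fdmod C) (X N : {vspace M}) :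
    submodule X -> submodule N -> (X <= N)%VS ->
    (forall i c x, (0 < i)%N -> c \in Cn i -> x \in N -> act M c x \in X) ->
  exists (S : grmod Cn) (e : 'Hom(M, S)),
    [/\ in_grade0 S, forall c x, x \in N -> e (act M c x) = act S c (e x),
        forall x, x \in N -> (e x == 0) = (x \in X) &
        forall s, exists2 x, x \in N & e x = s].
Proof.
move=> sX sN sXN posX; pose V := (N :\: X)%VS; pose SV : vectType F := subvs_of V.
pose pi := addv_pi1 N X; pose e : 'Hom(M, SV) := (linfun (vsproj V) \o pi)%VF.
pose v (s : SV) : M := vsval s.
have vl : linear v by move=> k a b; rewrite /v linearP.
have piV x : pi x \in V by rewrite /pi /addv_pi1 memv_pi.
have ve x : v (e x) = pi x by rewrite /v /e comp_lfunE lfunE /= vsprojK.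
have vN s : v s \in N by apply: (subvP (diffvSl N X)); apply: subvsP.
have piX x : x \in X -> pi x = 0.
  move=> xX; have xNX : x \in (N + X)%VS by apply: (subvP (addvSr _ _)).
  have := addv_pi1_pi2 xNX; rewrite addv_pi2_id // -/pi => /(canRL (addrK x)) ->.
  by rewrite subrr.
have eX x : x \in X -> e x = 0 by move=> xX; rewrite /e comp_lfunE piX // linear0.
have eB x : x \in N -> x - v (e x) \in X.
  move=> xN; have xNX : x \in (N + X)%VS by apply: (subvP (addvSl _ _)).
  by rewrite ve -{1}(addv_pi1_pi2 xNX) -/pi addrAC subrr add0r memv_pi2.
have ev s : e (v s) = s.
  rewrite /e comp_lfunE; have -> : pi (v s) = v s.
    by rewrite /pi /addv_pi1 daddv_pi_id ?capv_diff // subvsP.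
  by rewrite lfunE /= vsvalK.
pose a c (s : SV) : SV := e (act M c (v s)).
have ae c x : x \in N -> a c (e x) = e (act M c x).
  move=> xN; apply/eqP; rewrite eq_sym -subr_eq0 -!linearB /=.
  by apply/eqP/eX/sX/eB.
have lr c : linear (a c) by move=> k x y; rewrite /a vl !linearP.
have ll s : linear (a^~ s) by move=> k b c; rewrite /a act_addl act_scalel linearP.
have a1 s : a 1 s = s by rewrite /a act_one ev.
have aM b c s : a (b * c) s = a b (a c s) by rewrite [RHS](ae b _ (sN c _ (vN s))) /a act_mul.
pose Sm : fdmod C := FdMod (mkact1 lr ll a1) (mkactM lr ll aM).
have actS c (s : SV) : act Sm c s = a c s by rewrite [LHS](mkactE _ _ lr ll).
have pact (i : nat) (j : int) (c : C) (x : Sm) : c \in Cn i ->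
    x \in grade0_piece SV j -> act Sm c x \in grade0_piece SV (i%:Z + j).
  rewrite /grade0_piece => ci; case: (j =P 0) => [-> _|_]; last first.
    by rewrite memv0 => /eqP ->; rewrite linear0 mem0v.
  rewrite addr0; case: i ci => [|i] ci; first by rewrite eqxx memvf.
  by rewrite /= actS /a eX ?mem0v // (posX i.+1).
exists (@GrMod _ _ Cn Sm (@grade0_piece SV) (grade0_decomposition SV) pact), e; split=> //.
- by move=> c x xN; rewrite [RHS]actS ae.
- move=> x xN; apply/eqP/idP => [e0|/eX //].
  by have := eB x xN; rewrite e0 /v !linear0 addr0.
- by move=> s; exists (v s); [exact: vN | exact: ev].
Qed.

Lemma grade0_hom (M N : grmod Cn) (f : 'Hom(M, N)) :
  in_grade0 M -> in_grade0 N -> module_hom f -> graded_hom f.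
Proof.
move=> gM gN fh; split=> // i; rewrite gM gN.
by case: eqP => _; rewrite ?subvf // limg0 sub0v.
Qed.

Lemma grade0_act (M : grmod Cn) i c (x : M) :
  in_grade0 M -> (0 < i)%N -> c \in Cn i -> act M c x = 0.
Proof.
move=> gM i0 ci; apply/eqP; rewrite -memv0.
have x0 : x \in piece M 0 by rewrite gM eqxx memvf.
by have := piece_act ci x0; rewrite addr0 gM; case: i i0 ci.
Qed.

Lemma submodule0 (M : fdmod C) : submodule (0%VS : {vspace M}).
Proof. by move=> c x; rewrite !memv0 => /eqP ->; rewrite linear0. Qed.

Lemma submodule_preim (M N : fdmod C) (f : 'Hom(M, N)) (U : {vspace N}) :
  module_hom f -> submodule U -> submodule (f @^-1: U)%VS.
Proof. by move=> fh sU c x; rewrite -!memv_preim fh; apply: sU. Qed.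

Lemma submodule_add (M : fdmod C) (U V : {vspace M}) :
  submodule U -> submodule V -> submodule (U + V)%VS.
Proof.
move=> sU sV c x /memv_addP[u uU [v vV ->]].
by rewrite linearD memv_add ?sU ?sV.
Qed.

(** The summand is realised as the quotient [M / W]; the section [i] then lands in [U]. *)
Lemma grade0_summand (M : grmod Cn) (U W : {vspace M}) :
    in_grade0 M -> submodule U -> submodule W ->
    (U :&: W = 0)%VS -> (U + W = fullv)%VS ->
  exists (S : grmod Cn) (i : 'Hom(S, M)) (p : 'Hom(M, S)),
    [/\ in_grade0 S, \dim {:S} = \dim U, graded_hom i, graded_hom p &
        forall x, i (p x) = daddv_pi U W x].
Proof.
move=> gM sU sW dUW UW; pose q := daddv_pi U W.
have [|S [p [gS pl p0 ps]]] := @ex_subquotient M W fullv sW (@submodule_full _ _ M) (subvf _).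
  by move=> i c x i0 ci _; rewrite (grade0_act _ gM i0 ci) mem0v.
have ph : module_hom p by move=> c x; rewrite pl ?memvf.
have kp : lker p = W by apply/vspaceP => x; rewrite memv_ker p0 ?memvf.
have pim : limg p = fullv.
  apply/eqP; rewrite eqEsubv subvf; apply/subvP => s _; have [x _ <-] := ps s.
  by rewrite memv_img ?memvf.
have dW w : w \in W -> q w = 0.
  move=> wW; have wUW : w \in (U + W)%VS by rewrite UW memvf.
  have := daddv_pi_add dUW wUW.
  have -> : daddv_pi W U w = w by rewrite daddv_pi_id // capvC.
  by move/(canRL (addrK w)) => ->; rewrite subrr.
have dU u : u \in U -> q u = u by apply: daddv_pi_id.
have qh c x : q (act M c x) = act M c (q x).
  have : x \in (U + W)%VS by rewrite UW memvf.
  case/memv_addP => u uU [w wW ->].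
  rewrite !linearD /= (dU _ (sU c _ uU)) (dU _ uU) (dW _ (sW c _ wW)) (dW _ wW).
  by rewrite linear0.
pose i := (q \o p^-1)%VF.
have ip x : i (p x) = q x.
  rewrite comp_lfunE; apply/eqP; rewrite -subr_eq0 -(linearB q) /= dW //.
  by rewrite -kp memv_ker linearB /= limg_lfunVK ?pim ?memvf // subrr.
have ih : module_hom i.
  by move=> c s; have [x _ <-] := ps s; rewrite -ph !ip qh.
exists S, i, p; split=> //; first last.
- exact: (grade0_hom gM gS ph).
- exact: (grade0_hom gS gM ih).
have := limg_ker_dim p fullv; rewrite capfv kp pim.
have := dimv_disjoint_sum dUW; rewrite UW => -> /eqP.
by rewrite addnC eqn_add2r => /eqP.
Qed.

Lemma grade0_biproduct (M : grmod Cn) (U W : {vspace M}) :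
    in_grade0 M -> submodule U -> submodule W ->
    (U :&: W = 0)%VS -> (U + W = fullv)%VS ->
  exists (S T : grmod Cn) iU pU iV pV, @biproduct _ _ _ M S T iU pU iV pV /\
    [/\ in_grade0 S, in_grade0 T, \dim {:S} = \dim U & \dim {:T} = \dim W].
Proof.
move=> gM sU sW dUW UW.
have [S [iU [pU [gS dS giU gpU eU]]]] := grade0_summand gM sU sW dUW UW.
have [||T [iV [pV [gT dT giV gpV eV]]]] := grade0_summand gM sW sU.
- by rewrite capvC.
- by rewrite addvC.
exists S, T, iU, pU, iV, pV; split=> //; split=> // x.
by rewrite eU eV daddv_pi_add // UW memvf.
Qed.

Definition complemented_upto (k : nat) : Prop :=
  forall M : grmod Cn, in_grade0 M -> (\dim {:M} <= k)%N ->
  forall U : {vspace M}, submodule U ->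
  exists W : {vspace M}, [/\ submodule W, (U :&: W = 0)%VS & (U + W = fullv)%VS].

(** Semisimplicity up to dimension [k] reduces a property that is stable under
    direct sums to the irreducible modules. *)
Lemma grade0_ind k (Q : grmod Cn -> Prop) : complemented_upto k ->
    (forall M : grmod Cn, (fullv : {vspace M}) = 0%VS -> Q M) ->
    (forall M : grmod Cn, irreducible M -> in_grade0 M -> Q M) ->
    (forall (M U V : grmod Cn) iU pU iV pV, @biproduct _ _ _ M U V iU pU iV pV -> Q U -> Q V -> Q M) ->
  forall M : grmod Cn, in_grade0 M -> (\dim {:M} <= k)%N -> Q M.
Proof.
move=> ck Q0 Qi Qb M; have [n] := ubnP (\dim {:M}).
elim: n M => // n IH M; rewrite ltnS => dn gM dk.
have [M0|M0] := eqVneq (fullv : {vspace M}) 0%VS; first exact: Q0.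
have [iM|nM] := EM (irreducible M); first exact: Qi.
have [U [sU U0 Uf]] : exists U : {vspace M}, [/\ submodule U, U != 0%VS & U != fullv].
  apply: contrapT => h; apply: nM; split=> [|U sU]; first exact/eqP.
  have [->|U0] := eqVneq U 0%VS; [by left | right].
  by have [//|Uf] := eqVneq U fullv; case: h; exists U.
have [W [sW dUW UW]] := ck M gM dk U sU.
have dM : (\dim U + \dim W = \dim {:M})%N by rewrite -dimv_disjoint_sum ?UW.
have dU : (0 < \dim U)%N by rewrite lt0n dimv_eq0.
have dW : (0 < \dim W)%N.
  rewrite lt0n dimv_eq0; apply: contraNneq Uf => W0.
  by rewrite -UW W0 addv0.
have [S [T [iU [pU [iV [pV [bM [gS gT dS dT]]]]]]]] := grade0_biproduct gM sU sW dUW UW.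
have ltS : (\dim U < \dim {:M})%N by rewrite -dM -addn1 leq_add2l.
have ltT : (\dim W < \dim {:M})%N by rewrite -dM -add1n leq_add2r.
apply: Qb bM _ _; apply: IH => //; rewrite ?dS ?dT.
- exact: leq_trans ltS dn.
- exact: leq_trans (ltnW ltS) dk.
- exact: leq_trans ltT dn.
- exact: leq_trans (ltnW ltT) dk.
Qed.

Lemma submodule_img (M N : fdmod C) (f : 'Hom(M, N)) (U : {vspace M}) :
  submodule U -> (forall c x, x \in U -> f (act M c x) = act N c (f x)) ->
  submodule (f @: U)%VS.
Proof.
move=> sU fU c _ /memv_imgP[x xU ->]; rewrite -fU //.
by apply: memv_img; apply: sU.
Qed.

Hypothesis kC : koszul Cn.

(** Both arguments are reduced to irreducible modules, along the splittings that
    are available for modules of dimension at most [k]. *)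
Lemma ext_linear_upto k (L L' : grmod Cn) : complemented_upto k ->
  irreducible L \/ (\dim {:L} <= k)%N -> in_grade0 L ->
  in_grade0 L' -> (\dim {:L'} <= k)%N -> ext_linear L L'.
Proof.
move=> ck hL gL gL' dL'.
have irrL (L0 : grmod Cn) : irreducible L0 -> in_grade0 L0 -> ext_linear L0 L'.
  move=> iL0 gL0; apply: (@grade0_ind k (fun N => ext_linear L0 N)) => //.
  - by move=> M M0; apply: ext_linear_zeror.
  - by move=> M iM gM; apply: koszul_ext_linear.
  - by move=> M U V iU pU iV pV b; apply: ext_linear_sumr b.
case: hL => [iL|dL]; first exact: irrL.
apply: (@grade0_ind k (fun N => ext_linear N L')) => //.
- by move=> M M0; apply: ext_linear_zerol.
- by move=> M U V iU pU iV pV b; apply: (ext_linear_suml gC b).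
Qed.

(** Take a maximal proper submodule [N] containing [U].  As [N] is semisimple by
    induction and [M / N] is irreducible, the vanishing of [ext^1(M / N, N)] in
    degree 0 gives a retraction [e'] of [M] onto [N], and the preimage under [e'] of a
    complement of [U] in [N] is a complement of [U] in [M]. *)
Lemma complemented_all k : complemented_upto k.
Proof.
elim: k => [|k IH] M gM dM U sU.
  exists fullv; split; first exact: submodule_full.
    apply/eqP; rewrite capvf -dimv_eq0 -leqn0 (leq_trans _ dM) // dimvS ?subvf //.
  by apply/eqP; rewrite eqEsubv subvf addvSr.
have [Uf|Uf] := eqVneq U fullv.
  exists 0%VS; split; [exact: submodule0 | exact: capv0 | by rewrite addv0].
pose good (N : {vspace M}) := [/\ submodule N, N != fullv & (U <= N)%VS].
have [N [sN Nf sUN] maxN] := @ex_max_vspace _ _ good U (And3 sU Uf (subvv U)).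
have posM (X : {vspace M}) i c (x : M) : (0 < i)%N -> c \in Cn i -> act M c x \in X.
  by move=> i0 ci; rewrite (grade0_act _ gM i0 ci) mem0v.
have [|L [g [gL gl g0 gs]]] := @ex_subquotient M N fullv sN (@submodule_full _ _ M) (subvf _).
  by move=> i c x i0 ci _; apply: posM ci.
have gh : module_hom g by move=> c x; rewrite gl ?memvf.
have kg : lker g = N by apply/vspaceP => x; rewrite memv_ker g0 ?memvf.
have gim : limg g = fullv.
  apply/eqP; rewrite eqEsubv subvf; apply/subvP => s _; have [x _ <-] := gs s.
  by rewrite memv_img ?memvf.
have iL : irreducible L.
  split=> [L0|V sV].
    case/eqP: Nf; apply/eqP; rewrite eqEsubv subvf; apply/subvP => x _.
    by rewrite -kg memv_ker -memv0 -L0 memvf.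
  pose K := (g @^-1: V)%VS; have sNK : (N <= K)%VS.
    apply/subvP => x; rewrite -kg memv_ker -memv_preim => /eqP ->; exact: mem0v.
  have VE s : s \in V -> exists2 x, x \in K & g x = s.
    by move=> sV'; have [x _ e] := gs s; exists x; rewrite // -memv_preim e.
  have [Kf|Kf] := eqVneq K fullv.
    right; apply/eqP; rewrite eqEsubv subvf; apply/subvP => s _.
    by have [x _ <-] := gs s; rewrite memv_preim -/K Kf memvf.
  left; have KN : K = N.
    apply: maxN => //; split=> //; last exact: subv_trans sUN sNK.
    exact: submodule_preim.
  apply/eqP; rewrite -subv0; apply/subvP => s /VE[x]; rewrite KN -kg memv_ker.
  by move=> /eqP -> <-; rewrite mem0v.
have [|S [e [gS el e0 es]]] := @ex_subquotient M 0%VS N (@submodule0 M) sN (sub0v _).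
  by move=> i c x i0 ci _; apply: posM ci.
have dS : (\dim {:S} <= k)%N.
  have dNM : (\dim N < \dim {:M})%N.
    rewrite ltnNge; apply: contra Nf => h; by rewrite eqEdim subvf.
  have -> : (fullv : {vspace S}) = (e @: N)%VS.
    apply/eqP; rewrite eqEsubv subvf andbT; apply/subvP => s _.
    by have [x xN <-] := es s; apply: memv_img.
  have := limg_ker_dim e N; move: dNM dM => h1 h2 h3.
  by rewrite -ltnS; apply: leq_trans h2; apply: leq_ltn_trans h1; rewrite -h3 leq_addl.
have [||||||e' ge' ee'] := @ext_linear_extend L M S g 0 e.
- by apply: (ext_linear_upto IH) => //; left.
- by [].
- exact: grade0_hom.
- by [].
- by move=> c x; rewrite kg => xN; apply: el.
- move=> j x _; rewrite gM gS subr0.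
  by case: eqP => _; rewrite ?memvf // memv0 => /eqP ->; rewrite linear0 mem0v.
rewrite kg in ee'; have [eh _] := ge'.
have sE : submodule (e @: U)%VS.
  by apply: submodule_img => // c x xU; apply: el; apply: (subvP sUN).
have [W [sW dW eW]] := IH S gS dS _ sE.
exists (e' @^-1: W)%VS; split.
- exact: (@submodule_preim M (shift S 0) e' W eh sW).
- apply/eqP; rewrite -subv0; apply/subvP => u; rewrite memv_cap -memv_preim.
  case/andP => uU; have uN := subvP sUN u uU; rewrite ee' // => uW.
  rewrite -e0 // -memv0 -dW memv_cap uW andbT; exact: memv_img.
apply/eqP; rewrite eqEsubv subvf; apply/subvP => x _.
have : e' x \in (e @: U + W)%VS by rewrite eW memvf.
case/memv_addP => _ /memv_imgP[u uU ->] [w wW ew].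
apply/memv_addP; exists u => //; exists (x - u); last by rewrite addrC subrK.
by rewrite -memv_preim linearB /= ew ee' ?(subvP sUN) // addrC addKr.
Qed.

Lemma ext_linear_grade0 (L L' : grmod Cn) :
  in_grade0 L -> in_grade0 L' -> ext_linear L L'.
Proof.
move=> gL gL'; pose k := maxn (\dim {:L}) (\dim {:L'}).
apply: (ext_linear_upto (@complemented_all k)) => //; last exact: leq_maxr.
by right; apply: leq_maxl.
Qed.

End ExtOne.

(** * The radical filtration of a Koszul algebra *)

Section RadicalKoszul.
Variables (F : fieldType) (C : falgType F) (Cn : nat -> {vspace C}).
Hypothesis gC : graded_algebra Cn.

Local Notation pr := (cpi gC).

Lemma cpi_in k x : pr k x \in intpiece Cn k.
Proof. exact: dproj_in. Qed.

Lemma cpi_id k x : x \in intpiece Cn k -> pr k x = x.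
Proof. exact: dproj_id. Qed.

Lemma cpi_out k j x : x \in intpiece Cn j -> k != j -> pr k x = 0.
Proof. exact: dproj_out. Qed.

Lemma cpi_ind (P : C -> Prop) :
  P 0 -> (forall x y, P x -> P y -> P (x + y)) ->
  (forall n x, x \in Cn n -> P x) -> forall x, P x.
Proof.
move=> P0 PD Pn; apply: (homogeneous_ind (intpiece_graded gC)) => //.
by case=> n x /=; [exact: Pn | rewrite memv0 => /eqP ->].
Qed.

Lemma cpi_neg k x : (k < 0)%R -> pr k x = 0.
Proof. by case: k => // k _; have := cpi_in (Negz k) x; rewrite memv0 => /eqP. Qed.

(** The ideal of elements of degree at least [n], which turns out to be the [n]th
    power of the radical. *)
Definition degree_ge (n : int) (x : C) : Prop := forall k, (k < n)%R -> pr k x = 0.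

Lemma degree_geM m n x y : degree_ge m x -> degree_ge n y -> degree_ge (m + n) (x * y).
Proof.
move=> xm yn k kmn; have [s [us s0 sx]] := dproj_support (intpiece_graded gC).
rewrite -(sx x) mulr_suml linear_sum big1 // => i _ /=.
rewrite -[k](subrKC i) [LHS](cpi_mul gC _ _ (cpi_in i x)).
have [im|im] := Order.TotalTheory.ltP i m; first by rewrite xm // mul0r.
rewrite yn ?mulr0 // -(ltrD2l i) subrKC.
by apply: Order.POrderTheory.lt_le_trans kmn _; rewrite lerD2r.
Qed.

Lemma degree_ge0 x : degree_ge 0 x.
Proof. by move=> k; apply: cpi_neg. Qed.

Lemma degree_ge_mul n c x : degree_ge n x -> degree_ge n (c * x).
Proof. by move=> xn; rewrite -[n]add0r; apply: degree_geM => //; apply: degree_ge0. Qed.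

Lemma degree_ge_lin n k x y : degree_ge n x -> degree_ge n y -> degree_ge n (k *: x + y).
Proof. by move=> xn yn i il; rewrite linearP /= xn // yn // scaler0 addr0. Qed.

Lemma degree_ge_eq0 : exists n : nat, forall x, degree_ge n x -> x = 0.
Proof.
have [dCn _ _] := gC; have [s [_ s0 _]] := dproj_support dCn.
exists (\max_(i <- s) i).+1 => x xn.
apply: (dproj_eq0 (dW := intpiece_graded gC)) => k.
have [kn|nk] := Order.TotalTheory.ltP k (\max_(i <- s) i).+1%:Z; first exact: xn.
case: k nk => // k nk; apply/eqP; rewrite -memv0.
suff <- : Cn k = 0%VS by apply: (cpi_in k x).
apply: s0; apply/negP => ks.
have := @leq_bigmax_seq _ s xpredT (fun i => i) k ks isT.
by move: nk; rewrite lez_nat ltnNge => /negP.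
Qed.

Definition pos_part : {vspace C} := lker (pr 0).

Lemma mem_pos_part x : x \in pos_part <-> degree_ge 1 x.
Proof.
rewrite memv_ker; split=> [/eqP x0 k|x1]; last by apply/eqP/x1.
case: k => [[|k]|k] // _; exact: cpi_neg.
Qed.

Lemma homogeneous_degree_ge n x : x \in Cn n -> degree_ge n x.
Proof.
move=> xn k kn; apply: (@cpi_out _ n) => //.
by apply: contraTneq kn => ->; rewrite Order.POrderTheory.ltxx.
Qed.

Lemma pos_part_piece n : (0 < n)%N -> (Cn n <= pos_part)%VS.
Proof.
move=> n0; apply/subvP => x xn; apply/mem_pos_part => k k1.
by apply: (homogeneous_degree_ge xn); apply: Order.POrderTheory.lt_le_trans k1 _.
Qed.

Lemma pos_part_left c x : x \in pos_part -> c * x \in pos_part.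
Proof. by move=> /mem_pos_part h; apply/mem_pos_part/degree_ge_mul. Qed.

Lemma ex_maximal_left_ideal (W : {vspace C}) : left_ideal W -> W != fullv ->
  exists2 I, maximal_left_ideal I & (W <= I)%VS.
Proof.
move=> lW Wf.
have [I [lI If sWI] maxI] := @ex_max_vspace _ _
  (fun I => [/\ left_ideal I, I != fullv & (W <= I)%VS]) W (And3 lW Wf (subvv W)).
exists I => //; split=> // K lK sIK.
have [->|Kf] := eqVneq K fullv; [by right | left].
by apply: maxI => //; split=> //; apply: subv_trans sWI sIK.
Qed.

Lemma left_ideal_add (I J : {vspace C}) :
  left_ideal I -> left_ideal J -> left_ideal (I + J)%VS.
Proof.
move=> /left_idealP lI /left_idealP lJ; apply/left_idealP => b x.
by case/memv_addP => u uI [v vJ ->]; rewrite mulrDr memv_add ?lI ?lJ.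
Qed.

(** A nilpotent left ideal lies in every maximal left ideal [I]: otherwise
    [1 = a + p] with [a] in [I] and [p] nilpotent, and [1 - p ^+ n] is in [I]. *)
Lemma pos_part_sub_jacobson : (pos_part <= jacobson C)%VS.
Proof.
apply/subvP => x xp; apply/mem_jacobson => I [lI If maxI].
have lp : left_ideal pos_part by apply/left_idealP => b y; apply: pos_part_left.
have [IE|] := maxI _ (left_ideal_add lI lp) (addvSl _ _).
  by rewrite -IE; apply: (subvP (addvSr _ _)).
move=> e; have : 1 \in (I + pos_part)%VS by rewrite e memvf.
case/memv_addP => a aI [p /mem_pos_part pp e1].
have aE : a = 1 - p by rewrite e1 addrK.
have [N N0] := degree_ge_eq0; move/left_idealP: lI => lI.
have pn (n : nat) : degree_ge n (p ^+ n) /\ 1 - p ^+ n \in I.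
  elim: n => [|n [IH1 IH2]]; first by split; [exact: degree_ge0 | rewrite expr0 subrr mem0v].
  split; first by rewrite exprS -[n.+1]add1n PoszD; apply: degree_geM.
  have -> : 1 - p ^+ n.+1 = a + p * (1 - p ^+ n).
    by rewrite aE mulrBr mulr1 -exprS addrA subrK.
  by rewrite memvD // lI.
have [/N0 p0] := pn N; rewrite p0 subr0 => I1.
by case/eqP: If; apply/eqP; rewrite eqEsubv subvf; apply/subvP => y _; rewrite -(mulr1 y) lI.
Qed.

Lemma regular_piece_act (i : nat) (j : int) (c : C) (x : regular C) :
  c \in Cn i -> x \in intpiece Cn j -> act (regular C) c x \in intpiece Cn (i%:Z + j).
Proof. by move=> ci xj; rewrite regular_actE; apply: intpieceM. Qed.

Definition regular_gr : grmod Cn :=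
  @GrMod _ _ Cn (regular C) (intpiece Cn)
    (intpiece_graded gC) regular_piece_act.

Lemma pos_part_submodule : submodule (pos_part : {vspace regular C}).
Proof. by move=> c x; rewrite regular_actE; apply: pos_part_left. Qed.

Lemma ex_grade0_quotient : exists (L : grmod Cn) (e : 'Hom(regular_gr, L)),
  [/\ in_grade0 L, graded_hom e, limg e = fullv & lker e = pos_part].
Proof.
have [|L [e [gL el e0 es]]] := @ex_subquotient F C Cn (regular C) pos_part fullv
   pos_part_submodule (@submodule_full _ _ _) (subvf _).
  move=> i c x i0 ci _; rewrite regular_actE; apply/mem_pos_part.
  have := degree_geM (homogeneous_degree_ge ci) (@degree_ge0 x).
  rewrite addr0 => h k k1; apply: h.
  exact: Order.POrderTheory.lt_le_trans k1 _.
have ke : lker e = pos_part.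
  by apply/vspaceP => x; rewrite memv_ker e0 ?memvf.
exists L, e; split=> //; last first.
  apply/eqP; rewrite eqEsubv subvf; apply/subvP => s _; have [x _ <-] := es s.
  by rewrite memv_img ?memvf.
apply/graded_homP; split=> [c x|k x xk]; first by rewrite el ?memvf.
rewrite gL; case: eqP => [_|/eqP k0]; first exact: memvf.
by rewrite memv0 e0 ?memvf // memv_ker (cpi_out xk) // eq_sym.
Qed.

Hypothesis kC : koszul Cn.

(** The quotient by the positive part is semisimple, so the image of the radical
    has a complement there.  Its preimage [V] satisfies [rad + V = C]; were [V] proper,
    a maximal left ideal containing [V] would be everything. *)
Lemma jacobson_sub_pos_part : (jacobson C <= pos_part)%VS.
Proof.
have [L [e [gL ge eim ke]]] := ex_grade0_quotient.
have [eh _] := ge; have ehE c x : e (c * x) = act L c (e x).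
  by rewrite -(eh c x) [act _ _ _]regular_actE.
have sJ : submodule (e @: jacobson C)%VS.
  apply: (@submodule_img F C (regular C) L e (jacobson C)) => c x.
    by rewrite regular_actE; apply: rad_mull.
  by move=> _; apply: eh.
have [W [sW dW eW]] := complemented_all gC kC gL (leqnn _) sJ.
pose V : {vspace C} := (e @^-1: W)%VS.
have lV : left_ideal V.
  by apply/left_idealP => b x; rewrite -!memv_preim ehE; apply: sW.
have JV x : exists2 j, j \in jacobson C & x - j \in V.
  have : e x \in (e @: jacobson C + W)%VS by rewrite eW memvf.
  case/memv_addP => _ /memv_imgP[j jJ ->] [w wW ex].
  by exists j => //; rewrite -memv_preim linearB /= ex addrC addKr.
have [Vf|Vf] := eqVneq V fullv.
  apply/subvP => x xJ; rewrite -ke memv_ker -memv0 -dW memv_cap memv_img //=.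
  by rewrite memv_preim -/V Vf memvf.
have [I mI sVI] := ex_maximal_left_ideal lV Vf; have [_ If _] := mI.
case/eqP: If; apply/eqP; rewrite eqEsubv subvf; apply/subvP => x _.
have [j /mem_jacobson jJ xj] := JV x.
by rewrite -(subrK j x) memvD ?jJ // (subvP sVI).
Qed.

Lemma jacobsonE : jacobson C = pos_part.
Proof.
by apply/eqP; rewrite eqEsubv jacobson_sub_pos_part pos_part_sub_jacobson.
Qed.

(** Vanishing of [ext^1] between modules in grade 0 in the degrees [r >= 2] says
    that there are no generators in degree [r]: the projection of the positive part
    onto its new generators of degree [r] extends to a morphism defined on the
    whole algebra, and that morphism kills 1 for degree reasons. *)
Lemma piece_decomposable (r : nat) : (1 < r)%N ->
  (Cn r <= \sum_(i < r | (0 < i)%N) Cn i * Cn (r - i)%N)%VS.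
Proof.
move=> r1; set Y := (X in (_ <= X)%VS).
have YE i j x y : (0 < i)%N -> (0 < j)%N -> (i + j)%N = r -> x \in Cn i -> y \in Cn j ->
    x * y \in Y.
  move=> i0 j0 ij xi yj; have ltir : (i < r)%N by rewrite -ij -addn1 leq_add2l.
  apply: (subvP (sumv_sup (Ordinal ltir) _ (subvv _))) => //=.
  by rewrite -ij addKn memv_mul.
have Y0 c y : c \in Cn 0 -> y \in Y -> c * y \in Y.
  move=> c0 /memv_sumP[vs vsP ->]; rewrite mulr_sumr; apply: memv_suml => i i0.
  apply: (subvP (sumv_sup i i0 (subvv _))).
  have [_ _ mulC] := gC; have : c * vs i \in (Cn 0 * (Cn i * Cn (r - i)%N))%VS.
    by rewrite memv_mul // vsP.
  by rewrite prodvA; apply: subvP; apply: prodvSl; apply: mulC.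
(* The quotient of [pos_part] by [X] is [Cn r / Y], in degree [r]. *)
pose X := (pos_part :&: (pr r @^-1: Y))%VS.
have XE x : (x \in X) = (x \in pos_part) && (pr r x \in Y).
  by rewrite memv_cap -memv_preim.
have posX i c x : (0 < i)%N -> c \in Cn i -> x \in pos_part -> c * x \in X.
  move=> i0 ci xp; rewrite XE pos_part_left //=.
  have -> : pr r (c * x) = c * pr (r%:Z - i%:Z) x.
    rewrite -(@cpi_mul _ _ _ gC i%:Z) // subrKC //.
  have [ir|ri|ir] := ltngtP i r.
  - have -> : r%:Z - i%:Z = (r - i)%N by rewrite subzn // ltnW.
    apply: (YE i (r - i)%N) => //; first by rewrite subn_gt0.
      by rewrite subnKC // ltnW.
    exact: (cpi_in (r - i)%N x).
  - rewrite cpi_neg ?mulr0 ?mem0v //.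
    by rewrite subr_lt0 ltz_nat.
  by rewrite ir subrr; move: xp; rewrite memv_ker => /eqP ->; rewrite mulr0 mem0v.
have sX : submodule (X : {vspace regular C}).
  move=> c x; rewrite regular_actE => xX; have := xX; rewrite XE => /andP[xp xY].
  elim/cpi_ind: c => [|a b ha hb|[|n] c cn].
  - by rewrite mul0r mem0v.
  - by rewrite mulrDl memvD.
  - rewrite XE pos_part_left //= -[Posz r]add0r (@cpi_mul _ _ _ gC 0) //.
    exact: Y0.
  by apply: posX cn xp.
have sXp : (X <= pos_part)%VS by apply: capvSl.
have [|S [e [gS el e0 es]]] := @ex_subquotient F C Cn (regular C) X pos_part sX
    pos_part_submodule sXp.
  by move=> i c x i0 ci xp; rewrite regular_actE; apply: (posX i).
have [L [g [gL gg gim kg]]] := ex_grade0_quotient.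
have [||||||e' ge' ee'] := @ext_linear_extend F C Cn gC L regular_gr S g r e.
- exact: ext_linear_grade0.
- by move=> [r1']; rewrite r1' in r1.
- exact: gg.
- exact: gim.
- by move=> c x; rewrite kg => xp; apply: el.
- move=> k x; rewrite kg => xp xk; rewrite gS subr_eq0.
  case: eqP => [_|/eqP kr]; first exact: memvf.
  by rewrite memv0 e0 // XE xp /= (cpi_out xk) ?mem0v // eq_sym.
have /graded_homP[eh ep] := ge'.
(* The grade-[r] module has nothing in degree 0. *)
have e'1 : e' 1 = 0.
  have := ep 0 1 (intpiece1 gC); rewrite /= gS sub0r oppr_eq0.
  by case: eqP => [[r0]|_]; [rewrite r0 in r1 | rewrite memv0 => /eqP].
apply/subvP => x xr; have xp : x \in pos_part.
  by apply: (subvP (pos_part_piece _)) xr; apply: ltnW.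
have : x \in X.
  rewrite -e0 // -ee' ?kg //.
  have -> : x = act regular_gr x 1 by rewrite [RHS]regular_actE mulr1.
  by rewrite eh e'1 linear0.
by rewrite XE cpi_id // => /andP[].
Qed.

(** Iterating the decomposition of the piece of degree [n] ends with sums of products
    of [n] elements of degree 1. *)
Lemma piece_sub_radpow n : (Cn n <= radpow C n)%VS.
Proof.
have [m] := ubnP n; elim: m n => // m IH [|[|n]] lt; first exact: subvf.
  by rewrite /= expv1 jacobsonE pos_part_piece.
apply: subv_trans (piece_decomposable _) _ => //.
apply/subv_sumP => i i0; apply/prodvP => x y xi yj.
have si : (i <= n.+2)%N by apply: ltnW.
have im : (i < m)%N by apply: leq_trans (ltn_ord i) _.
have jm : (n.+2 - i < m)%N.
  by apply: (@leq_trans n.+2); rewrite ?ltn_subrL ?i0.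
rewrite -(subnKC si); apply: radpowM.
  exact: subvP (IH _ im) _ xi.
exact: subvP (IH _ jm) _ yj.
Qed.

Lemma radpow_le m n : (m <= n)%N -> (radpow C n <= radpow C m)%VS.
Proof.
move/subnKC <-; elim: (n - m)%N => [|k IH]; first by rewrite addn0.
by rewrite addnS; apply: subv_trans IH; apply: radpow_decr.
Qed.

(** A Koszul algebra is graded by its radical filtration: the radical is the positive
    part, and elements of degree [n > 0] are sums of products of [n] elements of degree 1. *)
Lemma koszul_radpow n x : x \in radpow C n <-> degree_ge n x.
Proof.
split=> [|xn].
  elim: n x => [|n IH] x; first by move=> _; apply: degree_ge0.
  pose K := vspaceof (degree_ge n.+1).
  have KE y : y \in K <-> degree_ge n.+1 y.
    apply: mem_vspaceof => [k _|c u v]; [exact: linear0 | exact: degree_ge_lin].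
  rewrite radpowS => xr; apply/KE; apply: subvP xr; apply/prodvP => a b.
  rewrite jacobsonE => /mem_pos_part a1 /IH bn; apply/KE.
  by rewrite -[n.+1]add1n PoszD; apply: degree_geM.
have [s [_ _ <-]] : exists s : seq int, [/\ True, True & \sum_(k <- s) pr k x = x].
  have [s [_ _ h]] := dproj_support (intpiece_graded gC).
  by exists s; split=> //; apply: h.
apply: (big_ind (fun y => y \in radpow C n)) => [|u v|k _]; [exact: mem0v | exact: memvD |].
have [kn|] := Order.TotalTheory.ltP k n; first by rewrite xn ?mem0v.
case: k => // k; rewrite lez_nat => nk; apply: (subvP (radpow_le nk)).
by apply: (subvP (piece_sub_radpow k)); apply: (cpi_in k x).
Qed.

End RadicalKoszul.

(** * Descent of the Koszul property along a ring extension *)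

Section Pullback.
Variables (F : fieldType) (C' C : falgType F).
Variables (Cn' : nat -> {vspace C'}) (Cn : nat -> {vspace C}) (phi : 'Hom(C', C)).
Hypotheses (phi1 : phi 1 = 1) (phiM : forall a b, phi (a * b) = phi a * phi b).
Hypothesis phi_piece : forall n a, a \in Cn' n -> phi a \in Cn n.

Definition pull_act (M : fdmod C) : 'Hom(C', 'End(M)) := (act M \o phi)%VF.

Lemma pull_actE M a : pull_act M a = act M (phi a).
Proof. by rewrite comp_lfunE. Qed.

Lemma pull_act1 M : pull_act M 1 = \1%VF.
Proof. by rewrite pull_actE phi1 act1. Qed.

Lemma pull_actM M a b : pull_act M (a * b) = (pull_act M a \o pull_act M b)%VF.
Proof. by rewrite !pull_actE phiM actM. Qed.

Definition pull_mod (M : fdmod C) : fdmod C' := FdMod (pull_act1 M) (@pull_actM M).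

Lemma pull_modE (M : fdmod C) a (x : M) : act (pull_mod M) a x = act M (phi a) x.
Proof. by rewrite [act _ a]pull_actE. Qed.

Lemma pull_piece_act (M : grmod Cn) (i : nat) (j : int) (a : C') (x : pull_mod M) :
  a \in Cn' i -> x \in piece M j -> act (pull_mod M) a x \in piece M (i%:Z + j).
Proof. by move=> ai xj; rewrite [act _ a]pull_actE; apply/piece_act/xj/phi_piece. Qed.

Definition pull (M : grmod Cn) : grmod Cn' :=
  @GrMod _ _ Cn' (pull_mod M) (piece M) (piece_decomposition M) (@pull_piece_act M).

Lemma pullE (M : grmod Cn) a (x : M) : act (pull M) a x = act M (phi a) x.
Proof. exact: pull_modE. Qed.

Lemma pull_hom (M N : grmod Cn) (f : 'Hom(M, N)) :
  graded_hom f -> graded_hom (f : 'Hom(pull M, pull N)).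
Proof.
move=> [fh fp]; split; last exact: fp.
by move=> a x; rewrite pullE [RHS]pullE fh.
Qed.

(** A graded dual basis of [C] as a [C']-module, in degree 0; it is expressed through
    the multiplication of [C] alone, so that it can act on any [C]-module. *)
Definition graded_extension_basis : Prop :=
  exists (J : finType) (b : J -> C) (kappa : J -> 'Hom(C, C')),
  [/\ forall j, b j \in Cn 0,
      forall j a y, kappa j (phi a * y) = a * kappa j y,
      forall j n y, y \in Cn n -> kappa j y \in Cn' n &
      forall y, \sum_j phi (kappa j y) * b j = y].

Hypothesis extB : graded_extension_basis.

(** Dual bases are transitive: the products of the two families form a dual basis. *)
Lemma pull_dual_basis (P : grmod Cn) :
  graded_dual_basis P -> graded_dual_basis (pull P).
Proof.
move=> [I [d [x [f [xd fl fd fx]]]]]; have [J [b [k [b0 kl kd kx]]]] := extB.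
exists (I * J)%type, (fun ij => d ij.1), (fun ij => act P (b ij.2) (x ij.1)).
exists (fun ij => (k ij.2 \o f ij.1)%VF); split.
- by case=> i j /=; rewrite -[d i]add0r; apply: piece_act.
- by case=> i j a y /=; rewrite pullE !comp_lfunE fl kl.
- case=> i j e y ye /=; rewrite comp_lfunE; have := fd i e y ye.
  case: (e - d i) => n /=; first exact: kd.
  by rewrite memv0 => /eqP ->; rewrite linear0 mem0v.
move=> y; rewrite -[RHS]fx -(pair_bigA _ (fun i j =>
  act (pull P) ((k j \o f i)%VF y) (act P (b j) (x i)))) /=.
apply: eq_bigr => i _; rewrite -[in RHS](kx (f i y)) act_suml; apply: eq_bigr => j _.
by rewrite pullE comp_lfunE act_mul.
Qed.

Hypothesis gC : graded_algebra Cn.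

Lemma pull_projective (L : grmod Cn) (P : resolution L) n :
  graded_projective (pull (P n)).
Proof.
by apply/dual_basis_projective/pull_dual_basis/(projective_dual_basis gC)/res_projective.
Qed.

Definition pull_resolution (L : grmod Cn) (P : resolution L) : resolution (pull L) :=
  @Resolution _ _ _ (pull L) (fun n => pull (P n)) (diff P) (aug P) (@pull_projective L P)
    (fun n => pull_hom (diff_hom P n)) (pull_hom (aug_hom P)) (aug_onto P)
    (aug_exact P) (diff_exact P).

Section PositivePart.
Variable M : grmod Cn.

(** The submodule [C_+ M]. *)
Definition pos_span : {vspace M} :=
  <<[seq act M c x | c <- vbasis (pos_part gC), x <- vbasis {:M}]>>%VS.

Lemma mem_pos_span n c (x : M) : (0 < n)%N -> c \in Cn n -> act M c x \in pos_span.
Proof.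
move=> n0 cn; have cp := subvP (pos_part_piece gC n0) _ cn.
rewrite (coord_vbasis cp) act_suml; apply: memv_suml => i _.
rewrite (coord_vbasis (memvf x)) linear_sum; apply: memv_suml => j _.
rewrite /= act_scalel linearZ /= !memvZ // memv_span //; apply/allpairsP.
by exists ((vbasis (pos_part gC))`_i, (vbasis {:M})`_j); rewrite !mem_nth ?size_tuple.
Qed.

Lemma pos_span_sub (U : {vspace M}) :
    (forall n c x, (0 < n)%N -> c \in Cn n -> act M c x \in U) ->
  (pos_span <= U)%VS.
Proof.
move=> h; apply/span_subvP => _ /allpairsP[[c x] [/= cB _ ->]].
have cp := vbasis_mem cB; suff -> : c = c - cpi gC 0 c.
  elim/(cpi_ind gC): (c) => [|a b ha hb|[|n] a an].
  - by rewrite linear0 subr0 act_zerol mem0v.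
  - by rewrite (linearD (cpi gC 0)) opprD addrACA act_addl memvD.
  - by rewrite cpi_id // subrr act_zerol mem0v.
  - by rewrite (cpi_out gC (j := n.+1%:Z)) // subr0 (h n.+1).
by move: cp; rewrite memv_ker => /eqP ->; rewrite subr0.
Qed.

Lemma pos_span_submodule : submodule pos_span.
Proof.
move=> c x; rewrite (_ : act M c x \in _ = (x \in act M c @^-1: pos_span)%VS); last first.
  by rewrite memv_preim.
apply/subvP/pos_span_sub => n a y n0 an; rewrite -memv_preim.
elim/(cpi_ind gC): (c) => [|b d hb hd|m b bm].
- by rewrite act_zerol mem0v.
- by rewrite act_addl memvD.
- rewrite -act_mul; apply: (@mem_pos_span (m + n)%N); first by rewrite addn_gt0 n0 orbT.
  by have [_ _ /(_ m n) /prodvP] := gC; apply.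
Qed.

End PositivePart.

Hypothesis gen : forall n, (0 < n)%N -> (Cn n <= (phi @: Cn' n) * {:C})%VS.
Hypothesis compl : forall (M : fdmod C) (W U : {vspace M}),
  submodule W -> submodule U -> (W <= U)%VS ->
  (forall n c x, (0 < n)%N -> c \in Cn n -> act M c x \in W) ->
  exists V : {vspace M}, [/\ submodule V, (U + V = fullv)%VS & (U :&: V <= W)%VS].

(** As [C_+ M = C'_+ M] for every [C]-module [M], a [C']-morphism from [M] to a module
    in a single grade kills [C_+ M]; if it is [C]-linear on [im d] then it can be
    made [C]-linear everywhere by means of a complement of [im d] modulo [C_+ M]. *)
Lemma extend_linear (L P M : grmod Cn) (r : int) (d : 'Hom(P, M)) (f : 'Hom(P, shift L r))
    (g : 'Hom(pull M, shift (pull L) r)) :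
    in_grade0 L -> graded_hom d -> graded_hom f -> graded_hom g ->
    (forall p, f p = g (d p)) ->
  exists2 h : 'Hom(M, shift L r), graded_hom h & forall p, f p = h (d p).
Proof.
move=> gL gd gf [gh gp] fE; have [[dh _] [fh _]] := (gd, gf).
pose W := pos_span M; have gW w : w \in W -> g w = 0.
  suff s : (W <= lker (g : 'Hom(M, L)))%VS.
    by move/(subvP s); rewrite memv_ker => /eqP.
  apply: pos_span_sub => n c x n0 cn.
  pose ev : 'Hom(C, M) := linfun (fun c => act M c x).
  have evE b : ev b = act M b x.
    by apply: linfun_linear => k u v; rewrite act_addl act_scalel.
  rewrite -evE memv_preim; apply: subvP c cn; apply: subv_trans (gen n0) _.
  apply/prodvP => _ b /memv_imgP[a an ->] _; rewrite -memv_preim evE act_mul memv_ker.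
  have := gh a (act M b x); rewrite pullE => ->; apply/eqP.
  rewrite [LHS]pull_modE; exact: grade0_act gL n0 (phi_piece an).
have sW : submodule W := @pos_span_submodule M.
have sd : submodule (limg d).
  by apply: submodule_img => //; apply: submodule_full.
pose U := (limg d + W)%VS; have sU : submodule U by apply: submodule_add.
have [V [sV UV dUV]] := compl sW sU (addvSr _ _) (@mem_pos_span M).
(* The extension [h0] of [g] by zero on [V] is well defined since [g] kills [U :&: V]. *)
pose q := addv_pi1 U V; pose h0 : 'Hom(M, L) := ((g : 'Hom(M, L)) \o q)%VF.
have h0E m u : u \in U -> m - u \in V -> h0 m = g u.
  move=> uU muV; rewrite comp_lfunE; apply/eqP; rewrite -subr_eq0 -linearB /=.
  apply/eqP/gW/(subvP dUV); rewrite memv_cap; apply/andP; split.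
    by rewrite memvB // memv_pi1.
  have mUV : m \in (U + V)%VS by rewrite UV memvf.
  have -> : q m - u = (m - u) - addv_pi2 U V m.
    by rewrite addrAC; congr (_ - u); apply: canRL (addrK _) (addv_pi1_pi2 mUV).
  by rewrite memvB // memv_pi2.
have gU c u : u \in U -> g (act M c u) = act L c (g u).
  case/memv_addP => _ /memv_imgP[p _ ->] [w wW ->].
  rewrite !linearD /= -dh -!fE fh !(gW _ _) ?sW // linear0.
  by rewrite !addr0.
have h0h c m : h0 (act M c m) = act L c (h0 m).
  have mUV : m \in (U + V)%VS by rewrite UV memvf.
  case/memv_addP: mUV => u uU [v vV ->].
  rewrite (h0E _ (act M c u)) ?sU //; last by rewrite -linearB addrC addKr sV.
  by rewrite (h0E _ u) ?gU // addrC addKr.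
(* The component of [h0] that preserves degrees; it is still linear over [C],
   because elements of positive degree act as zero on [L]. *)
pose h : 'Hom(M, shift L r) := (h0 \o gpi M r)%VF.
have gE i a x : a \in intpiece Cn i -> gpi M r (act M a x) = act M a (gpi M (r - i) x).
  by move=> ai; rewrite -(gpi_act _ _ ai) subrKC.
have hE x : h x = h0 (gpi M r x) by rewrite comp_lfunE.
exists h => [|p].
  apply/graded_homP; split=> [c x|k x xk]; rewrite !hE.
    elim/(cpi_ind gC): (c) => [|a b ha hb|[|n] a an].
    - by rewrite !act_zerol !linear0.
    - by rewrite !act_addl !linearD /= ha hb.
    - by rewrite (gE 0) // subr0 h0h.
    rewrite (gE n.+1) // h0h.
    by rewrite (grade0_act _ gL _ an) // [RHS](grade0_act _ gL _ an).
  rewrite /= gL; case: eqP => [_|/eqP kr]; first exact: memvf.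
  rewrite memv0 /gpi (dproj_out _ xk) ?linear0 //.
  by apply: contraNneq kr => ->; rewrite subrr.
rewrite hE -(graded_hom_gpi _ _ gd) (h0E _ (d (gpi P r p))) ?subrr ?mem0v //; last first.
  by apply: (subvP (addvSl _ _)); rewrite memv_img ?memvf.
rewrite -fE (graded_hom_gpi _ _ gf) /gpi dproj_id //.
by rewrite /= gL subrr eqxx memvf.
Qed.

(** A cocycle over [C] is a coboundary [g \o d] over [C'], because the modules involved
    restrict to modules in grade 0, and [extend_linear] makes [g] linear over [C]. *)
Theorem koszul_descent : koszul Cn' -> koszul Cn.
Proof.
move=> kC'; have gC' := kC'.1; split=> // L L' n r _ gL _ gL' [P [f [[gf fd] nb]]].
apply: contrapT => nr; apply: nb.
have cf : @cocycle _ _ _ (pull L) (shift (pull L') r) (pull_resolution P) n f.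
  by split; [exact: (pull_hom gf) | exact: fd].
have : @coboundary _ _ _ (pull L) (shift (pull L') r) (pull_resolution P) n f.
  by apply: (ext_linear_grade0 gC' kC') nr cf.
case: n f gf fd nr cf => [|n] f gf fd nr cf //= [g gg fg].
have [|h gh fh] := extend_linear gL' (diff_hom P n) gf gg.
  by move=> p; rewrite fg comp_lfunE.
by exists h => //; apply/lfunP => p; rewrite comp_lfunE fh.
Qed.

End Pullback.

(** * Modules over the associated graded algebra *)

Section GrSemisimple.
Variables (F : fieldType) (B : falgType F).

(** [B / rad B] is semisimple: take [V] minimal with [U + V = B]; were there [x] in
    [U] and [V] outside of a maximal left ideal [I], the intersection of [V] and [I]
    would still do. *)
Lemma left_ideal_complement (U : {vspace B}) :
    left_ideal U -> (jacobson B <= U)%VS ->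
  exists V : {vspace B}, [/\ left_ideal V, (U + V = fullv)%VS & (U :&: V <= jacobson B)%VS].
Proof.
move=> /left_idealP lU sJU.
pose good V := [/\ left_ideal V, (jacobson B <= V)%VS & (U + V = fullv)%VS].
have good_full : good fullv.
  split; [exact: left_ideal_fullv | exact: subvf |].
  by apply/eqP; rewrite eqEsubv subvf addvSr.
have [V [/left_idealP lV sJV UV] minV] := ex_min_vspace good_full.
exists V; split=> //; first exact/left_idealP.
apply/subvP => x; rewrite memv_cap => /andP[xU xV]; apply/mem_jacobson => I mI.
apply: contrapT => /negP xI; have [/left_idealP lI If maxI] := mI.
have lIx : left_ideal (I + (amulr x @: fullv))%VS.
  apply/left_idealP => b y /memv_addP[a aI [_ /memv_imgP[c _ ->] ->]].
  rewrite mulrDr memv_add ?lI //; apply/memv_imgP; exists (b * c); first exact: memvf.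
  by rewrite !lfunE /= mulrA.
have Ix : (I + (amulr x @: fullv) = fullv)%VS.
  have [e|//] := maxI _ lIx (addvSl _ _).
  case/negP: xI; rewrite -e; apply: (subvP (addvSr _ _)); apply/memv_imgP.
  by exists 1; rewrite ?memvf // lfunE /= mul1r.
suff e : (V :&: I)%VS = V by move: xV; rewrite -e memv_cap (negbTE xI) andbF.
apply: minV (capvSl _ _); split.
- apply/left_idealP => b y; rewrite !memv_cap => /andP[yV yI].
  by rewrite lV ?lI.
- apply/subvP => y yJ; rewrite memv_cap (subvP sJV) //=.
  by move/mem_jacobson: yJ; apply.
apply/eqP; rewrite eqEsubv subvf -UV; apply/subvP => _ /memv_addP[u uU [v vV ->]].
have : v \in (I + (amulr x @: fullv))%VS by rewrite Ix memvf.
case/memv_addP => i iI [_ /memv_imgP[b _ ->] ev].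
rewrite lfunE /= in ev; apply/memv_addP; exists (u + b * x).
  by rewrite memvD // lU.
exists i; last by rewrite ev addrAC addrA.
rewrite memv_cap iI andbT.
have -> : i = v - b * x by rewrite ev addrK.
by rewrite memvB // lV.
Qed.

(** Modulo the action of the positive part, [gr B] acts through [B]. *)
Lemma gr_symbol0_act (M : fdmod (gr B)) (W : {vspace M}) :
    (forall n c x, (0 < n)%N -> c \in gr_piece B n -> act M c x \in W) ->
  forall c, exists b, forall x, act M c x - act M (gr_symbol B 0 b) x \in W.
Proof.
move=> posW; apply: (cpi_ind (gr_graded B)) => [|c d [a ha] [b hb]|n c cn].
- by exists 0 => x; rewrite (linear0 (gr_symbol B 0)) subrr mem0v.
- exists (a + b) => x; rewrite (linearD (gr_symbol B 0)) !act_addl opprD addrACA.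
  by rewrite memvD.
case: n cn => [/memv_imgP[b _ ->]|n cn]; first by exists b => x; rewrite subrr mem0v.
by exists 0 => x; rewrite (linear0 (gr_symbol B 0)) act_zerol subr0 (posW n.+1).
Qed.

(** Take [V] maximal with [U :&: V] inside [W].  For [x] outside of [U + V], the elements of [B]
    that send [x] into [U + V] form a left ideal [I] containing the radical, and a
    complement [I'] of it provides the larger submodule [V + I' x]. *)
Lemma gr_complement (M : fdmod (gr B)) (W U : {vspace M}) :
    submodule W -> submodule U -> (W <= U)%VS ->
    (forall n c x, (0 < n)%N -> c \in gr_piece B n -> act M c x \in W) ->
  exists V : {vspace M}, [/\ submodule V, (U + V = fullv)%VS & (U :&: V <= W)%VS].
Proof.
move=> sW sU sWU posW.
pose good V := [/\ submodule V, (W <= V)%VS & (U :&: V <= W)%VS].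
have [V [sV sWV dUV] maxV] := @ex_max_vspace _ _ good W (And3 sW (subvv W) (capvSr _ _)).
exists V; split=> //; apply/eqP; rewrite eqEsubv subvf; apply/subvP => x _.
apply: contrapT => /negP xUV.
pose psi := gr_symbol B 0; have psiM a b y : act M (psi (a * b)) y = act M (psi a) (act M (psi b) y).
  by rewrite -act_mul gr_symbolM ?memvf.
pose ev : 'Hom(B, M) := linfun (fun b => act M (psi b) x).
have evE b : ev b = act M (psi b) x.
  by apply: linfun_linear => k u v; rewrite linearP act_addl act_scalel.
have sUV := submodule_add sU sV.
pose I := (ev @^-1: (U + V))%VS.
have IE b : (b \in I) = (act M (psi b) x \in (U + V)%VS) by rewrite -memv_preim evE.
have lI : left_ideal I.
  by apply/left_idealP => a b; rewrite !IE psiM; apply: sUV.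
have psiJ b : b \in jacobson B -> psi b = 0.
  have e1 : radpow B 1 = jacobson B by apply: expv1.
  by rewrite -e1 => bJ; apply/eqP; rewrite gr_symbol_eq0 // memvf.
have sJI : (jacobson B <= I)%VS.
  by apply/subvP => b bJ; rewrite IE psiJ // act_zerol mem0v.
have [I' [/left_idealP lI' II' dII']] := left_ideal_complement lI sJI.
have e : (V + ev @: I')%VS = V.
  apply: maxV; last exact: addvSl.
  split.
  - move=> c _ /memv_addP[v vV [_ /memv_imgP[b bI ->] ->]].
    have [a ha] := gr_symbol0_act posW c; rewrite linearD /= evE.
    have -> : act M c v + act M c (act M (psi b) x) =
      (act M c v + (act M c (act M (psi b) x) - act M (psi a) (act M (psi b) x)))
        + ev (a * b) by rewrite evE psiM -addrA subrK.
    rewrite memv_add ?memv_img ?lI' // memvD ?sV //.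
    exact: subvP sWV _ (ha _).
  - exact: subv_trans sWV (addvSl _ _).
  apply/subvP => u; rewrite memv_cap => /andP[uU /memv_addP[v vV [_ /memv_imgP[b bI ->] eu]]].
  have bI2 : b \in I.
    rewrite IE -evE; have -> : ev b = u - v by rewrite eu addrC addKr.
    by rewrite memv_add // memvN.
  have bJ : b \in jacobson B by apply: (subvP dII'); rewrite memv_cap bI2.
  apply: (subvP dUV); rewrite memv_cap uU eu evE psiJ // act_zerol addr0.
  exact: vV.
have : 1 \in (I + I')%VS by rewrite II' memvf.
case/memv_addP => i iI [i' i'I e1]; case/negP: xUV.
have -> : x = act M (psi 1) x by rewrite /psi gr_symbol1 act_one.
rewrite e1 linearD act_addl memvD //; first by rewrite -IE.
apply: (subvP (addvSr _ _)); rewrite -e; apply: (subvP (addvSr _ _)).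
by rewrite -evE memv_img.
Qed.

End GrSemisimple.

(** * The associated graded algebra over the Koszul subalgebra *)

Section GradedSubalgebra.
Variables (F : fieldType) (B : falgType F) (A : {aspace B}).
Hypothesis A1 : 1 \in A.
Variable An : nat -> {vspace subvs_of A}.
Hypothesis kA : koszul An.
Hypothesis radA : ((linfun (vsval : subvs_of A -> B) @: jacobson (subvs_of A)) * {:B})%VS
    = jacobson B.

Local Notation A' := (subvs_of A).
Let gA : graded_algebra An := kA.1.
Let iota : 'Hom(A', B) := linfun (vsval : A' -> B).

Lemma iotaE a : iota a = vsval a. Proof. by rewrite lfunE. Qed.

Lemma iota1 : iota 1 = 1.
Proof. by rewrite iotaE; apply/eqP; rewrite [_ == _]algid_eq1. Qed.

Lemma iotaM a b : iota (a * b) = iota a * iota b.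
Proof. by rewrite !iotaE. Qed.

Lemma iota_radpow n a : a \in radpow (subvs_of A) n -> iota a \in radpow B n.
Proof.
suff : (iota @: radpow (subvs_of A) n <= radpow B n)%VS.
  by move=> s an; apply: (subvP s); apply: memv_img.
elim: n => [|n IH]; first exact: subvf.
apply/subvP => _ /memv_imgP[x xr ->]; rewrite memv_preim.
apply: subvP x xr; rewrite [radpow (subvs_of A) _]radpowS; apply/prodvP => c d cJ dn.
rewrite -memv_preim iotaM radpowS memv_mul //; last first.
  by apply: (subvP IH); apply: memv_img.
by rewrite -radA -[iota c]mulr1 memv_mul ?memvf // memv_img.
Qed.

(** As [rad B] is an ideal, [rad B * (rad B) ^ n = (rad A) B (rad B) ^ n = (rad A) (rad B) ^ n],
    so that the powers of [rad A] can be collected on the left. *)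
Lemma radpow_generated n :
  (radpow B n <= (iota @: radpow (subvs_of A) n) * {:B})%VS.
Proof.
elim: n => [|n IH].
  apply/subvP => b _; rewrite -[b]mul1r -iota1 memv_mul ?memvf //.
  by apply: memv_img; apply: memvf.
rewrite radpowS -radA; apply/subvP => x.
have s : (iota @: jacobson (subvs_of A) * {:B} * radpow B n <=
    iota @: radpow (subvs_of A) n.+1 * {:B})%VS.
  rewrite -prodvA; apply: subv_trans (prodvSr _ (radpow_left B n)) _.
  apply: subv_trans (prodvSr _ IH) _; rewrite prodvA; apply: prodvSl.
  apply/prodvP => _ _ /memv_imgP[a aJ ->] /memv_imgP[b bn ->].
  by rewrite -iotaM memv_img // [radpow (subvs_of A) _]radpowS memv_mul.
exact: subvP s x.
Qed.

Lemma radpow_degree n a : a \in radpow (subvs_of A) n <-> degree_ge gA n a.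
Proof. exact: koszul_radpow. Qed.

Lemma piece_radpow n a : a \in An n -> a \in radpow (subvs_of A) n.
Proof. by move=> an; apply/radpow_degree; apply: homogeneous_degree_ge. Qed.

(** Modulo [rad ^ n.+1], an element of [rad ^ n] is its component of degree [n]. *)
Lemma radpow_lead n a : a \in radpow (subvs_of A) n ->
  a - cpi gA n a \in radpow (subvs_of A) n.+1.
Proof.
move=> /radpow_degree an; apply/radpow_degree => k kn; rewrite linearB /=.
have [lt|gt|->] := Order.TotalTheory.ltgtP k n%:Z.
- rewrite (an k lt) (cpi_out gA (cpi_in gA n a)) ?subrr //.
  by apply: contraTneq lt => ->; rewrite Order.POrderTheory.ltxx.
- by move: kn; rewrite -addn1 PoszD ltzD1 Order.TotalTheory.leNgt gt.
by rewrite (cpi_id gA (cpi_in gA n a)) subrr.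
Qed.

Let N := \dim {:B}.

(** The morphism from [A] to [gr B] that sends [a] in degree [n] to its class in
    [rad ^ n B / rad ^ n.+1 B]. *)
Definition gr_embed : 'Hom(A', gr B) :=
  \sum_(n < N) (gr_symbol B n \o (iota \o cpi gA n))%VF.

Lemma gr_symbol_zero n x : x \in radpow B n.+1 -> gr_symbol B n x = 0.
Proof.
by move=> xn; apply/eqP; rewrite gr_symbol_eq0 // (subvP (radpow_decr B n)).
Qed.

Lemma gr_embedE n a : a \in An n -> gr_embed a = gr_symbol B n (iota a).
Proof.
move=> an; rewrite /gr_embed sum_lfunE.
have [lt|ge] := ltnP n N.
  rewrite (bigD1 (Ordinal lt)) //= big1 ?addr0 => [|i ni].
    by rewrite !comp_lfunE cpi_id.
  rewrite !comp_lfunE (cpi_out gA (j := n)) ?linear0 //.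
have -> : iota a = 0.
  by apply/eqP; rewrite -memv0 -(radpow_nil ge); apply/iota_radpow/piece_radpow.
rewrite linear0 big1 // => i _; rewrite !comp_lfunE (cpi_out gA (j := n)) ?linear0 //.
by apply: contraTneq ge => -[<-]; rewrite -ltnNge ltn_ord.
Qed.

Lemma gr_embed_piece n a : a \in An n -> gr_embed a \in gr_piece B n.
Proof.
by move=> an; rewrite (gr_embedE an); apply/memv_img/iota_radpow/piece_radpow.
Qed.

Lemma gr_embed1 : gr_embed 1 = 1.
Proof. by rewrite (@gr_embedE 0) ?iota1 ?gr_symbol1 //; apply: intpiece1 gA. Qed.

Lemma gr_embedM a b : gr_embed (a * b) = gr_embed a * gr_embed b.
Proof.
have [_ _ mulA] := gA.
elim/(cpi_ind gA): a => [|a a' ha ha'|m a am]; first by rewrite !(mul0r, linear0).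
  by rewrite mulrDl !linearD /= mulrDl ha ha'.
elim/(cpi_ind gA): b => [|b b' hb hb'|n b bn]; first by rewrite !(mulr0, linear0).
  by rewrite mulrDr !linearD /= mulrDr hb hb'.
have abn : a * b \in An (m + n)%N by move/prodvP: (mulA m n); apply.
rewrite (gr_embedE abn) (gr_embedE am) (gr_embedE bn) gr_symbolM ?iotaM //.
  by apply/iota_radpow/piece_radpow.
by apply/iota_radpow/piece_radpow.
Qed.

(** A product [r * b] with [r] in [(rad A) ^ n] has the same symbol as [r' * b], where [r'] is
    the component of degree [n] of [r]. *)
Lemma gr_generated n :
  (gr_piece B n <= (gr_embed @: An n) * {:gr B})%VS.
Proof.
apply/subvP => _ /memv_imgP[x xn ->]; rewrite memv_preim.
apply: subvP x xn; apply: subv_trans (radpow_generated n) _.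
apply/prodvP => _ b /memv_imgP[r rn ->] _; rewrite -memv_preim.
have cn : cpi gA n r \in An n := cpi_in gA n r.
have -> : gr_symbol B n (iota r * b) = gr_embed (cpi gA n r) * gr_symbol B 0 b.
  rewrite (gr_embedE cn) gr_symbolM ?memvf //; last exact/iota_radpow/piece_radpow.
  rewrite addn0; apply/eqP; rewrite -subr_eq0 -linearB -mulrBl -linearB /=.
  by apply/eqP/gr_symbol_zero/radpow_right/iota_radpow/radpow_lead.
by rewrite memv_mul ?memvf // memv_img.
Qed.

Hypothesis projA : forall P : fdmod B, projective P -> projective (restriction A1 P).

Lemma regular_projective : projective (regular B).
Proof.
move=> M P g f gh gs fh; pose m := (g^-1)%VF (f 1).
have gm : g m = f 1 by rewrite limg_lfunVK ?gs ?memvf.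
pose h : 'Hom(regular B, M) := linfun (fun b : B => act M b m).
have hE b : h b = act M b m.
  by apply: (@linfun_linear F B M) => k u v; rewrite act_addl act_scalel.
exists h => [c b|]; first by rewrite !hE regular_actE act_mul.
apply/lfunP => b; rewrite comp_lfunE hE gh gm -fh regular_actE.
by rewrite mulr1.
Qed.

(** The dual basis comes from a splitting of a free cover of [B] over [A]. *)
Lemma ex_dual_basis : exists (J : finType) (b : J -> B) (i : J -> 'Hom(B, A')),
  (forall j a x, i j (iota a * x) = a * i j x) /\ forall x, \sum_j iota (i j x) * b j = x.
Proof.
pose RB := restriction A1 (regular B).
have actR a (x : B) : act RB a x = iota a * x.
  by rewrite [act _ _](res_actE (regular B) a) regular_actE iotaE.
pose J : finType := 'I_(\dim {:B}); pose b (j : J) : B := (vbasis {:B})`_j.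
pose g := @free_lift F A' J RB b.
have gs : limg g = fullv.
  apply/eqP; rewrite eqEsubv subvf; apply/subvP => x _; apply/memv_imgP.
  exists ([ffun j : J => (coord (vbasis {:B}) j (x : B))%:A] : {ffun J -> A'}).
    exact: memvf.
  rewrite free_liftE {1}(coord_vbasis (memvf (x : B))); apply: eq_bigr => j _.
  by rewrite ffunE act_scalel act_one.
have [|h hh hg] := @projA _ regular_projective _ _ g \1%VF (free_lift_hom (M := RB) b) gs.
  by move=> c x; rewrite !id_lfunE.
exists J, b, (fun j => (free_coord A' j \o h)%VF); split=> [j a x|x].
  by rewrite !comp_lfunE -actR hh !free_coordE free_actE.
have e : g (h x) = x by rewrite -comp_lfunE hg id_lfunE.
rewrite -[RHS]e free_liftE; apply: eq_bigr => j _.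
by rewrite actR comp_lfunE free_coordE.
Qed.

(** The coordinate maps [i j] of a dual basis of [B] over [A] are [A]-linear, hence send
    [rad ^ n B = (rad A) ^ n B] to [(rad A) ^ n]; passing to the associated graded maps and
    using that [A] is its own associated graded algebra gives the coordinates [kappa j]. *)
Lemma gr_extension_basis : graded_extension_basis An (gr_piece B) gr_embed.
Proof.
have [J [b [i [il ib]]]] := ex_dual_basis.
have i_rad j n x : x \in radpow B n -> i j x \in radpow (subvs_of A) n.
  move=> xn; rewrite memv_preim; apply: subvP x xn.
  apply: subv_trans (radpow_generated n) _; apply/prodvP => _ c /memv_imgP[a an ->] _.
  by rewrite -memv_preim il radpow_right.
pose kf j (u : gr B) : A' := \sum_(n < N) cpi gA n (i j (gr_fun u n)).
have kl j : linear (kf j).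
  move=> k u v; rewrite scaler_sumr -big_split /=; apply: eq_bigr => n _.
  by rewrite gr_funD gr_funZ !linearP.
pose kappa j : 'Hom(gr B, A') := linfun (kf j).
have kE j n x : x \in radpow B n -> kappa j (gr_symbol B n x) = cpi gA n (i j x).
  move=> xn; rewrite (linfun_linear (kl j)) /kf.
  have [lt|ge] := ltnP n N; last first.
    have -> : x = 0 by apply/eqP; rewrite -memv0 -(radpow_nil ge).
    by rewrite !linear0 big1 // => m _; rewrite gr_fun0 !linear0.
  rewrite (bigD1 (Ordinal lt)) //= big1 ?addr0 => [|m nm]; last first.
    by rewrite gr_symbolE; move: nm; rewrite -val_eqE /= => /negbTE ->; rewrite !linear0.
  rewrite gr_symbolE eqxx; apply/esym/eqP; rewrite -subr_eq0 -!linearB /=; apply/eqP.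
  have /radpow_degree h := i_rad j n.+1 _ (gr_sigmaB xn).
  by apply: h; rewrite ltz_nat.
exists J, (fun j => gr_symbol B 0 (b j)), kappa; split.
- by move=> j; apply: memv_img; apply: memvf.
- move=> j a y; elim/(cpi_ind gA): a => [|a a' ha ha'|m a am].
  + by rewrite linear0 !mul0r linear0.
  + by rewrite linearD /= !mulrDl linearD /= ha ha'.
  elim/(cpi_ind (gr_graded B)): y => [|y y' hy hy'|n _ /memv_imgP[x xn ->]].
  + by rewrite mulr0 !linear0 mulr0.
  + by rewrite mulrDr !linearD /= mulrDr hy hy'.
  have ar := iota_radpow (piece_radpow am).
  rewrite (gr_embedE am) gr_symbolM // !kE ?radpowM // il PoszD.
  exact: cpi_mul.
- move=> j n _ /memv_imgP[x xn ->]; rewrite kE //; exact: (cpi_in gA n).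
elim/(cpi_ind (gr_graded B)) => [|y y' hy hy'|n _ /memv_imgP[x xn ->]].
- by apply: big1 => j _; rewrite !linear0 mul0r.
- rewrite -[in RHS]hy -[in RHS]hy' -big_split; apply: eq_bigr => j _.
  by rewrite !linearD mulrDl.
have cn j : cpi gA n (i j x) \in An n := cpi_in gA n (i j x).
transitivity (\sum_j gr_symbol B n (iota (i j x) * b j)); last by rewrite -linear_sum ib.
apply: eq_bigr => j _; rewrite kE // (gr_embedE (cn j)) gr_symbolM ?memvf //; last first.
  exact/iota_radpow/piece_radpow.
rewrite addn0; apply/esym/eqP; rewrite -subr_eq0 -linearB -mulrBl -linearB /=.
by apply/eqP/gr_symbol_zero/radpow_right/iota_radpow/radpow_lead/i_rad.
Qed.

End GradedSubalgebra.

Theorem proposition7p7 (F : fieldType) (B : falgType F) (A : {aspace B})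
    (A1 : 1 \in A) (An : nat -> {vspace subvs_of A}) :
  koszul An ->
  ((linfun (vsval : subvs_of A -> B) @: jacobson (subvs_of A)) * {:B})%VS
    = jacobson B ->
  (forall P : fdmod B, projective P -> projective (restriction A1 P)) ->
  koszul (gr_piece B).
Proof.
move=> kA radA projA.
apply: (koszul_descent (phi := gr_embed kA) _ _ _ _ _ _ _ kA).
- exact: gr_embed1.
- exact: gr_embedM.
- exact: gr_embed_piece.
- exact: (gr_extension_basis kA radA projA).
- exact: gr_graded.
- by move=> n _; apply: gr_generated.
- exact: gr_complement.
Qed.
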